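(* The class of triangle-free unit-square graphs is $(6,1)$-disjointness-expressing.
   Context: A unit-square graph is the graph associated to a finite set $P$ of points in the plane, with vertex set $P$ and two points adjacent iff their $\ell_\infty$-distance is at most 1 (equivalently, an intersection graph of axis-parallel unit squares). A class $\mathcal{C}$ of graphs is $(s,\kappa)$-disjointness-expressing if for some constant $\alpha>0$, for every positive integer $N$ and every $X\subseteq\{1,\dots,N\}$ one can define graphs $L(X)$ and $R(X)$, each containing a labelled set $S$ of special vertices, such that for all $A,B\subseteq\{1,\dots,N\}$: (i) the graph $g(L(A),R(B))$ obtained by identifying each vertex of $S$ in $L(A)$ with the corresponding vertex of $S$ in $R(B)$ is connected and has at most $\alpha N^{1/\kappa}$ vertices; (ii) the subgraph of $g(L(A),R(B))$ induced by the closed neighborhood $N[S]$ is independent of $A,B$ (for all $A,A',B,B'$ there is an isomorphism between these induced subgraphs that is the identity on $S$) and has at most $s$ vertices; (iii) $g(L(A),R(B))\in\mathcal{C}$ if and only if $A\cap B=\emptyset$. *)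

(* Defs.v *)
From Stdlib Require Import Reals.
From mathcomp Require Import all_boot.

Set Implicit Arguments.
Unset Strict Implicit.
Unset Printing Implicit Defensive.

Record graph := Graph { gV : finType; gadj : rel gV }.

Definition simple_graph (G : graph) : Prop :=
  symmetric (@gadj G) /\ irreflexive (@gadj G).

(* A graph with a labelled set of special vertices: label i : 'I_k names the
   special vertex [lab i]. Labels are required to be injective separately. *)
Record lgraph (k : nat) := LGraph { lg :> graph; lab : 'I_k -> gV lg }.

(* ---- Gluing g(L, R): identify lab L i with lab Rt i for every label i. ----
   Vertex set: all vertices of L, plus the non-special vertices of R. *)
Definition glueV k (L Rt : lgraph k) : finType :=
  (gV L + {w : gV Rt | w \notin codom (@lab k Rt)})%type.

Definition glue_adj k (L Rt : lgraph k) : rel (glueV L Rt) :=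
  fun x y =>
    match x, y with
    | inl a, inl b =>
        gadj a b ||
        [exists i : 'I_k, exists j : 'I_k,
           [&& lab L i == a, lab L j == b & gadj (lab Rt i) (lab Rt j)]]
    | inl a, inr w =>
        [exists i : 'I_k, (lab L i == a) && gadj (lab Rt i) (val w)]
    | inr w, inl a =>
        [exists i : 'I_k, (lab L i == a) && gadj (val w) (lab Rt i)]
    | inr w, inr w' => gadj (val w) (val w')
    end.

Definition glue k (L Rt : lgraph k) : graph := @Graph (glueV L Rt) (@glue_adj k L Rt).

Definition glab k (L Rt : lgraph k) (i : 'I_k) : gV (glue L Rt) := inl (lab L i).

Arguments glab : clear implicits.

Definition glueS k (L Rt : lgraph k) : {set gV (glue L Rt)} :=
  [set glab k L Rt i | i : 'I_k].

Arguments glueS : clear implicits.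

Definition closed_nbhd (G : graph) (S : {set gV G}) : {set gV G} :=
  S :|: [set v | [exists u in S, gadj u v]].

Definition induced_iso (G1 G2 : graph) (N1 : {set gV G1}) (N2 : {set gV G2})
    (f : gV G1 -> gV G2) : Prop :=
  {in N1 &, injective f} /\ f @: N1 = N2 /\
  {in N1 &, forall x y, gadj x y = gadj (f x) (f y)}.

Definition connected_graph (G : graph) : Prop :=
  forall x y : gV G, connect (@gadj G) x y.

Definition unit_square_graph (G : graph) : Prop :=
  exists p : gV G -> (R * R)%type, injective p /\
    forall x y : gV G,
      gadj x y <->
      (x <> y /\ Rle (Rabs (Rminus (fst (p x)) (fst (p y)))) R1
              /\ Rle (Rabs (Rminus (snd (p x)) (snd (p y)))) R1).

Definition triangle_free (G : graph) : Prop :=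
  ~ exists x y z : gV G,
      [/\ x != y, y != z, x != z &
          [&& gadj x y, gadj y z & gadj x z]].

Definition triangle_free_unit_square (G : graph) : Prop :=
  unit_square_graph G /\ triangle_free G.

(* ---- (s, kappa)-disjointness-expressing classes ----
   Subsets X of {1,...,N} are represented as X : {set 'I_N}
   (i.e. subsets of {0,...,N-1}, shifted by one). *)
Definition disjointness_expressing (C : graph -> Prop) (s kappa : nat) : Prop :=
  exists alpha : R, Rlt R0 alpha /\
  forall N : nat, 0 < N ->
  exists (k : nat) (L Rg : {set 'I_N} -> lgraph k),
    (forall X, simple_graph (L X) /\ injective (@lab k (L X))) /\
    (forall X, simple_graph (Rg X) /\ injective (@lab k (Rg X))) /\
    forall A B : {set 'I_N},
      connected_graph (glue (L A) (Rg B)) /\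
      Rle (INR #|gV (glue (L A) (Rg B))|)
          (Rmult alpha (Rpower (INR N) (Rinv (INR kappa)))) /\
      (forall A' B' : {set 'I_N},
         exists f : gV (glue (L A) (Rg B)) -> gV (glue (L A') (Rg B')),
           induced_iso (closed_nbhd (glueS k (L A) (Rg B)))
                       (closed_nbhd (glueS k (L A') (Rg B'))) f /\
           forall i : 'I_k, f (glab k (L A) (Rg B) i) = glab k (L A') (Rg B') i) /\
      #|closed_nbhd (glueS k (L A) (Rg B))| <= s /\
      (C (glue (L A) (Rg B)) <-> A :&: B = set0).

(* Main.v *)
(* Both graphs are cut out of one drawing.  Two chains of diamonds (induced
   4-cycles) leave a common vertex, one running to the right and one upwards;
   auxiliary vertices force every diamond to be oriented like the previous one, so
   each chain must advance by more than 1 per step.  A path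
   r_0, ..., r_n runs along the diagonal between the chains and is attached to
   both of them at its ends; since it advances by at most 1 per step in each
   coordinate, it is stretched: at every step it lags behind both chains by less
   than a constant.  R(B) is the part of the path between the special vertices r_2
   and r_{n-2}, decorated with a pendant path r_j, y, Y for each element of B.
   L(A) is the rest, with three extra vertices G on the first chain, supported by
   four vertices g, for each element of A.  A decoration y, Y and the vertices G
   belonging to the same element compete for the same place between r and the first
   chain, so no unit-square drawing exists when A and B meet.  When they are
   disjoint, explicit integer coordinates realise the glued graph. *)
Require Import Defs.
From Stdlib Require Import Reals Lra ZArith Lia PropExtensionality.
From mathcomp Require Import all_boot zify ssrZ.
Set Implicit Arguments.
Unset Strict Implicit.
Unset Printing Implicit Defensive.

Delimit Scope R_scope with Re.
Delimit Scope Z_scope with ZZ.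

(** * Nearness in the maximum metric *)

Definition near (p q : R * R) : Prop :=
  (Rabs (p.1 - q.1) <= 1 /\ Rabs (p.2 - q.2) <= 1)%Re.

Lemma near_bounds p q : near p q ->
  (p.1 <= q.1 + 1 /\ q.1 <= p.1 + 1 /\ p.2 <= q.2 + 1 /\ q.2 <= p.2 + 1)%Re.
Proof. by rewrite /near /Rabs; do 2 case: Rcase_abs; move=> *; lra. Qed.

Lemma far_split p q : ~ near p q ->
  (p.1 + 1 < q.1 \/ q.1 + 1 < p.1 \/ p.2 + 1 < q.2 \/ q.2 + 1 < p.2)%Re.
Proof. by rewrite /near /Rabs; do 2 case: Rcase_abs; move=> *; lra. Qed.

(** * Chains of diamonds *)

Ltac bounds :=
  repeat match goal with H : near _ _ |- _ =>
    move/near_bounds: H; case=> ? [] ? [] ? ? end.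

Ltac refute := try by (exfalso; lra).
Ltac split_far H := case/far_split: H => [?|[?|[?|?]]]; refute.

(** Otherwise [c] would lie in the box of width 1 and height 2 to the left of [v]. Its upper half
    contains [b] and its lower half [b'], so [c] would be near one of them. *)
Lemma tip_right (b b' v c : R * R) :
  near b v -> near b' v -> near v c -> ~ near b c -> ~ near b' c ->
  (b.1 < v.1 -> b'.1 < v.1 -> b'.2 < v.2 < b.2 -> v.1 < c.1)%Re.
Proof.
move=> *; bounds; case: (Rlt_le_dec v.1 c.1) => // ?.
by repeat match goal with H : ~ near _ _ |- _ => split_far H end.
Qed.

(* v_i, u_i, v_{i+1}, U_i is an induced 4-cycle, and the path U_i, q_{i+1}, U_{i+1}
   keeps u_{i+1} and U_{i+1} on the same sides as u_i and U_i. *)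
Record chain (n : nat) (v u U q : nat -> R * R) : Prop := Chain {
  chain_vu i : i <= n -> near (v i) (u i);
  chain_vU i : i <= n -> near (v i) (U i);
  chain_uv i : i < n -> near (u i) (v i.+1);
  chain_Uv i : i < n -> near (U i) (v i.+1);
  chain_Uq i : i < n -> near (U i) (q i.+1);
  chain_qU i : i < n -> near (q i.+1) (U i.+1);
  chain_far_v i : i < n -> ~ near (v i) (v i.+1);
  chain_far_uU i : i <= n -> ~ near (u i) (U i);
  chain_far_uu i : i < n -> ~ near (u i) (u i.+1);
  chain_far_uU' i : i < n -> ~ near (u i) (U i.+1);
  chain_far_Uu i : i < n -> ~ near (U i) (u i.+1);
  chain_far_UU i : i < n -> ~ near (U i) (U i.+1);
  chain_far_qv i : i < n -> ~ near (q i.+1) (v i.+1)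
}.

(* The diamond whose left corner is v has u as upper and U as lower corner. *)
Record right_tips (v u U : R * R) : Prop := RightTips {
  tips_ltu : (v.1 < u.1)%Re;
  tips_ltU : (v.1 < U.1)%Re;
  tips_Ulu : (U.2 + 1 < u.2)%Re
}.

(** Since [u] and [U] differ vertically by more than 1, their common neighbours [v] and [v'] differ
    vertically by less than 1 and must be far horizontally. Then [tip_right] puts [u'] and [U']
    beyond [v'], and [q] decides which of the two is the upper corner. *)
Lemma diamond_step (v u U v' u' U' q : R * R) :
  near v u -> near v U -> near u v' -> near U v' -> ~ near v v' ->
  near v' u' -> near v' U' -> ~ near u' U' ->
  ~ near u u' -> ~ near u U' -> ~ near U u' -> ~ near U U' ->
  near U q -> near q U' -> ~ near q v' ->
  right_tips v u U ->
  [/\ right_tips v' u' U',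
      (v.1 + 1 < v'.1)%Re, (u.1 < v'.1)%Re /\ (U.1 < v'.1)%Re,
      (u.1 + 1 < u'.1)%Re & (U.1 + 1 < U'.1)%Re].
Proof.
move=> vu vU uv Uv vv vu' vU' uU' uu Uu' uU'' UU Uq qU qv [h1 h2 h3].
have [h4 h5] : (v.1 + 1 < v'.1)%Re /\ (v.2 - 1 < v'.2 < v.2 + 1)%Re.
  by bounds; split_far vv; lra.
have h6 : (u.1 < v'.1 /\ U.1 < v'.1 /\ U.2 < v'.2 < u.2)%Re by bounds; lra.
have h7 : (v'.1 < u'.1)%Re by apply: (@tip_right u U); lra || done.
have h8 : (v'.1 < U'.1)%Re by apply: (@tip_right u U); lra || done.
(* If [U'] were the upper corner, [q], being near both [U] and [U'], would be caught near [v']. *)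
have h9 : (U'.2 + 1 < u'.2)%Re by bounds; split_far uU'; split_far qv; lra.
split; [by split| lra | by lra | |].
  by bounds; split_far uu; lra.
by bounds; split_far UU; lra.
Qed.

Record chain_step (v u U v' u' U' : R * R) : Prop := ChainStep {
  step_v : (v.1 + 1 < v'.1)%Re;
  step_uv : (u.1 < v'.1)%Re;
  step_Uv : (U.1 < v'.1)%Re;
  step_u : (u.1 + 1 < u'.1)%Re;
  step_U : (U.1 + 1 < U'.1)%Re
}.

Lemma chain_run n v u U q : chain n v u U q -> right_tips (v 0) (u 0) (U 0) ->
  (forall i, i <= n -> right_tips (v i) (u i) (U i)) /\
  (forall i, i < n -> chain_step (v i) (u i) (U i) (v i.+1) (u i.+1) (U i.+1)).
Proof.
move=> C t0.
have step i : i < n -> right_tips (v i) (u i) (U i) ->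
    right_tips (v i.+1) (u i.+1) (U i.+1) /\
    chain_step (v i) (u i) (U i) (v i.+1) (u i.+1) (U i.+1).
  move=> lt_in ti; have le_in := ltnW lt_in.
  have [t h1 [h2 h3] h4 h5] := diamond_step (chain_vu C le_in) (chain_vU C le_in)
    (chain_uv C lt_in) (chain_Uv C lt_in) (chain_far_v C lt_in) (chain_vu C lt_in)
    (chain_vU C lt_in) (chain_far_uU C lt_in) (chain_far_uu C lt_in)
    (chain_far_uU' C lt_in) (chain_far_Uu C lt_in) (chain_far_UU C lt_in)
    (chain_Uq C lt_in) (chain_qU C lt_in) (chain_far_qv C lt_in) ti.
  by split.
have tips i : i <= n -> right_tips (v i) (u i) (U i).
  by elim: i => // i IHi lt_in; have [] := step i lt_in (IHi (ltnW lt_in)).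
by split=> // i lt_in; have [] := step i lt_in (tips i (ltnW lt_in)).
Qed.

Lemma telescope_ge (f : nat -> R) n :
  (forall i, i < n -> (f i + 1 <= f i.+1)%Re) ->
  forall i k, i <= k <= n -> (f i + INR k <= f k + INR i)%Re.
Proof.
move=> fS i k /andP[/subnKC <-]; elim: (k - i) => [|l IHl] le_n.
  by rewrite addn0; lra.
rewrite addnS S_INR; rewrite addnS in le_n.
by have := fS _ le_n; have := IHl (ltnW le_n); lra.
Qed.

Lemma telescope_le (f : nat -> R) n :
  (forall i, i < n -> (f i.+1 <= f i + 1)%Re) ->
  forall i k, i <= k <= n -> (f k + INR i <= f i + INR k)%Re.
Proof.
move=> fS i k le_ikn.
(* Reflection: [2 i - f i] grows by at least 1 per step when [f] grows by at most 1. *)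
suff : (2 * INR i - f i + INR k <= 2 * INR k - f k + INR i)%Re by lra.
apply: (@telescope_ge (fun i => 2 * INR i - f i)%Re n) le_ikn => l /fS.
by rewrite S_INR; lra.
Qed.

(** * The local clash at one site *)

Lemma g_above (v u u' g : R * R) :
  near u v -> near v u' -> near u g -> near g u' -> ~ near g v ->
  (u.1 + 1 < u'.1 -> v.2 < u.2 -> v.2 < u'.2 ->
   v.2 + 1 < g.2 /\ u.1 < g.1 < u'.1)%Re.
(* Being near both [u] and [u'], the points [g] and [v] share a vertical strip of width less than 1.
   So they are far vertically, and nearness to [u] keeps [g] from being the lower one. *)
Proof. by move=> ? ? ? ? gv *; bounds; split_far gv; lra. Qed.

(** The same squeeze one level higher: [g] and [g'] lie above [u] at heights differing by less than
    1, so they are far horizontally. Their common neighbours [G] and [u] then share a strip of width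
    less than 1 and are far vertically. *)
Lemma G_above (u v v' g g' G : R * R) :
  near v u -> near v' u -> near u g -> near u g' -> near g G -> near G g' ->
  ~ near g g' -> ~ near u G ->
  (v.2 + 1 < g.2 -> v'.2 + 1 < g'.2 -> g.1 < u.1 < g'.1 ->
   [/\ g.1 + 1 < g'.1, u.2 + 1 < G.2, g.1 < G.1 < g'.1 & g.2 < G.2 /\ g'.2 < G.2])%Re.
Proof.
move=> ? ? ? ? ? ? gg uG *; bounds.
by split_far gg; split_far uG; (split; lra).
Qed.

Definition below (p q : R * R) : Prop := (p.2 + 1 < q.2)%Re.
Definition left_of (p q : R * R) : Prop := (p.1 + 1 < q.1)%Re.

(** Index 0 stands for the site itself. [A] and [B] bound what a path with steps of at most 1 can
    have reached at the site; the bounds with the constants 2 and 3 say that the chains have hardly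
    outrun it. The vertex [y] can then leave the path only to the upper left, towards [t], or to the
    lower right, towards [G], and in both directions there is no room for [Y]. *)
Lemma site_clash (u v g G t w r : nat -> R * R) (y Y : R * R) (A B : R) :
  near (r 0) (r 1) -> near (r 1) (r 2) -> near (r 1) y -> near y Y ->
  (forall i, i < 4 -> near (v i) (u i)) ->
  (forall i, i < 4 -> near (u i) (g i)) -> (forall i, i < 3 -> near (u i) (g i.+1)) ->
  (forall i, i < 3 -> near (g i) (G i)) -> (forall i, i < 3 -> near (G i) (g i.+1)) ->
  (forall i, i < 4 -> near (w i) (t i)) ->
  (forall i, i < 3 -> left_of (u i) (u i.+1)) ->
  (forall i, i < 4 -> ((g i).1 < (u i).1)%Re) ->
  (forall i, i < 4 -> below (v i) (g i)) ->
  (forall i, i < 4 -> ((v i.+1).2 < (u i).2)%Re) ->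
  (forall i, i < 4 -> ((v i.+1).2 < (v i).2 + 1)%Re) ->
  (forall i, i < 3 -> left_of (g i) (g i.+1)) ->
  (forall i, i < 3 -> below (u i) (G i)) ->
  (forall i, i < 3 -> ((g i).1 < (G i).1 < (g i.+1).1)%Re) ->
  (forall i, i < 3 -> ((g i).2 < (G i).2 /\ (g i.+1).2 < (G i).2)%Re) ->
  (forall i, i < 3 -> below (t i) (t i.+1)) ->
  (forall i, i < 4 -> ((w i.+1).1 < (t i).1)%Re) ->
  (forall i, i < 4 -> ((w i.+1).1 < (w i).1 + 1)%Re) ->
  ((r 0%N).1 <= A < (u 0%N).1)%Re -> ((r 0%N).2 <= B < (t 0%N).2)%Re ->
  ((u 3%N).1 < (r 2%N).1 + 2)%Re -> ((u 3%N).1 < (w 4%N).1 + 2)%Re ->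
  ((t 3%N).2 < (v 4%N).2 + 3)%Re ->
  below (u 0) (r 0) -> below (u 2) (r 2) -> left_of (t 0) (r 1) ->
  ~ near (G 0) (G 1) -> ~ near (G 1) (G 2) -> ~ near (G 2) (u 3) ->
  ~ near (r 0) (G 0) -> (forall i, i < 3 -> ~ near (r 2) (G i)) ->
  ~ near y (r 0) -> ~ near y (r 2) -> ~ near y (t 1) ->
  (forall i, i < 3 -> ~ near y (G i)) ->
  (forall i, i < 3 -> ~ near Y (r i)) -> (forall i, i < 3 -> ~ near Y (G i)) ->
  (forall i, i < 4 -> ~ near Y (t i)) -> False.
Proof.
Ltac inst3 H := move: (H 0 isT) (H 1 isT) (H 2 isT); clear H; move=> ? ? ?.
Ltac inst4 H := move: (H 0 isT) (H 1 isT) (H 2 isT) (H 3 isT); clear H; move=> ? ? ? ?.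
move=> rr0 rr1 ry yY vu ug ug' gG Gg wt uu gu vg vu' vv gg uG gGx gGy tt wt' ww.
move=> [? ?] [? ?] ? ? ? u0r0 u2r2 t0r1 G01 G12 G2u3 r0G0 r2G yr0 yr2 yt1 yG Yr YG Yt.
have [yG0 yG1 yG2] : [/\ ~ near y (G 0), ~ near y (G 1) & ~ near y (G 2)] by split; apply: yG.
have [YG0 YG1 YG2] : [/\ ~ near Y (G 0), ~ near Y (G 1) & ~ near Y (G 2)] by split; apply: YG.
have [Yr0 Yr1 Yr2] : [/\ ~ near Y (r 0), ~ near Y (r 1) & ~ near Y (r 2)] by split; apply: Yr.
have [r2G0 r2G1 r2G2] : [/\ ~ near (r 2) (G 0), ~ near (r 2) (G 1) & ~ near (r 2) (G 2)].
  by split; apply: r2G.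
have [Yt1 Yt2 Yt3] : [/\ ~ near Y (t 1), ~ near Y (t 2) & ~ near Y (t 3)] by split; apply: Yt.
rewrite /below /left_of in uu vg gg uG tt u0r0 u2r2 t0r1.
inst4 vu; inst4 ug; inst3 ug'; inst3 gG; inst3 Gg; inst4 wt; inst3 uu; inst4 gu; inst4 vg.
inst4 vu'; inst4 vv; inst3 gg; inst3 uG; inst3 gGx; inst3 gGy; inst3 tt; inst4 wt'; inst4 ww.
bounds.
clear yG YG Yr r2G Yt.
(* The points [G i] are more than 1 apart horizontally. Either [G 0] is more than 1 to the right of
   [r 0], or it is more than 1 below it. *)
split_far G01; split_far G12; split_far r0G0.
- split_far r2G0; split_far r2G1; split_far G2u3; split_far yr2.
  (* Here [y] is left of [r 2] and above [r 0]; the points [r] and [t] leave no place for [Y]. *)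
  + split_far yr0; split_far yt1; split_far yG0; split_far Yr1.
    * by split_far Yr0; split_far Yt1; split_far Yt2.
    * by split_far Yt2; split_far Yt3; split_far Yr2.
  (* Here [y] is below [r 2] and to the right of [r 0]; the points [r] and [G] leave no place for
     [Y]. *)
  + split_far yr0; split_far yG0; split_far yG1; split_far yt1; split_far Yr1.
    * by split_far Yr2; split_far YG1.
    * by split_far Yr0; split_far YG0; split_far YG1.
- split_far G2u3; split_far r2G2; split_far yr2.
  + split_far yr0; split_far yt1; split_far Yr1.
    * by split_far Yr0; split_far Yt1; split_far Yt2.
    * by split_far Yt2; split_far Yt3; split_far Yr2.
  + split_far yr0; split_far yG2; split_far yG1; split_far yt1; split_far Yr1.
    * by split_far Yr2; split_far YG2.
    * by split_far Yr0; split_far YG1; split_far YG2.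
Qed.

(** * The obstruction *)

Lemma nearP p q : near p q <->
  (p.1 <= q.1 + 1 /\ q.1 <= p.1 + 1 /\ p.2 <= q.2 + 1 /\ q.2 <= p.2 + 1)%Re.
Proof.
split=> [/near_bounds//|]; rewrite /near /Rabs.
by do 2 case: Rcase_abs; move=> *; lra.
Qed.

(** An equality of propositions rather than an equivalence, so that it rewrites under the negations
    in [chain] and [config]. *)
Definition keeps_near (f : R * R -> R * R) := forall p q, near (f p) (f q) = near p q.

(** The eight symmetries of the square. *)
Definition flip (b sx sy : bool) (p : R * R) : R * R :=
  let p' := if b then (p.2, p.1) else p in
  ((if sx then - p'.1 else p'.1)%Re, (if sy then - p'.2 else p'.2)%Re).

Lemma keeps_near_flip b sx sy : keeps_near (flip b sx sy).
Proof.
move=> p q; apply: propositional_extensionality.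
by rewrite !nearP /flip; case: b; case: sx; case: sy => /=; split; lra.
Qed.

Lemma chain_map f n v u U q : keeps_near f -> chain n v u U q ->
  chain n (f \o v) (f \o u) (f \o U) (f \o q).
Proof. by move=> fN []; split=> i le_in; rewrite /= fN; auto. Qed.

(* The chains v, u, U, q and w, t, s, p start at v 0 = w 0 and the path r at
   u 0 = t 0; the 4-cycle u n, r n, z, d and the edge between z and t n tie the far
   ends together.  Only one site j carries both decorations; g and G are indexed
   relative to it, and y is a neighbour of r (j + 1). *)
Record config (n j : nat) (v u U q w t s p r g G : nat -> R * R)
    (d z y Y : R * R) : Prop := Config {
  cf_X : chain n v u U q;
  cf_Y : chain n w t s p;
  cf_wv : w 0 = v 0;
  cf_ur : u 0 = r 0;
  cf_tr : t 0 = r 0;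
  cf_sU : ~ near (s 0) (U 0);
  cf_r i : i < n -> near (r i) (r i.+1);
  cf_r1v0 : ~ near (r 1) (v 0);
  cf_r1v1 : ~ near (r 1) (v 1);
  cf_far_ur i : 0 < i < n -> ~ near (u i) (r i);
  cf_unrn : near (u n) (r n);
  cf_und : near (u n) d;
  cf_dz : near d z;
  cf_zrn : near z (r n);
  cf_ztn : near z (t n);
  cf_unz : ~ near (u n) z;
  cf_drn : ~ near d (r n);
  cf_vnrn : ~ near (v n) (r n);
  cf_vnd : ~ near (v n) d;
  cf_j : 0 < j /\ j + 4 < n;
  cf_ug i : i < 4 -> near (u (i + j).-1) (g i);
  cf_gu i : i < 4 -> near (g i) (u (i + j));
  cf_gv i : i < 4 -> ~ near (g i) (v (i + j));
  cf_gG i : i < 3 -> near (g i) (G i);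
  cf_Gg i : i < 3 -> near (G i) (g i.+1);
  cf_gg i : i < 3 -> ~ near (g i) (g i.+1);
  cf_uG i : i < 3 -> ~ near (u (i + j)) (G i);
  cf_ry : near (r j.+1) y;
  cf_yY : near y Y;
  cf_tr1 : ~ near (t j) (r j.+1);
  cf_GG i : i < 2 -> ~ near (G i) (G i.+1);
  cf_G2u : ~ near (G 2) (u j.+3);
  cf_r0G : ~ near (r j) (G 0);
  cf_r2G i : i < 3 -> ~ near (r j.+2) (G i);
  cf_yr0 : ~ near y (r j);
  cf_yr2 : ~ near y (r j.+2);
  cf_yt : ~ near y (t j.+1);
  cf_yG i : i < 3 -> ~ near y (G i);
  cf_Yr i : i < 3 -> ~ near Y (r (i + j));
  cf_YG i : i < 3 -> ~ near Y (G i);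
  cf_Yt i : i < 4 -> ~ near Y (t (i + j))
}.

Lemma config_map f n j v u U q w t s p r g G d z y Y : keeps_near f ->
  config n j v u U q w t s p r g G d z y Y ->
  config n j (f \o v) (f \o u) (f \o U) (f \o q) (f \o w) (f \o t) (f \o s)
    (f \o p) (f \o r) (f \o g) (f \o G) (f d) (f z) (f y) (f Y).
Proof.
move=> fN []; intros; constructor; intros; rewrite /= ?fN; auto using chain_map.
all: by congr f.
Qed.

(** The pairwise far points [u], [U], [s] surround [o]; as [u] and [U] are on the right, [s] must be
    on the left. The diamonds of the two chains share the corner [u], so the second one opens
    upwards, and exchanging the axes gives it the orientation of the first. *)
Lemma swapped_tips (o u U v w s : R * R) :
  near o u -> near o U -> near o s -> near u v -> near U v -> near u w -> near s w ->
  ~ near o w -> ~ near u s -> ~ near s U ->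
  right_tips o u U ->
  right_tips (flip true false false o) (flip true false false u)
    (flip true false false s).
Proof.
move=> ? ? ? ? ? ? ? ow us sU [? ? ?]; bounds.
have ? : (s.1 < o.1)%Re.
  by case: (Rlt_le_dec s.1 o.1) => // ?; split_far us; split_far sU.
have ? : (o.2 + 1 < w.2)%Re by split_far ow.
by split; rewrite /flip /=; split_far us; lra.
Qed.

(** Otherwise [d] would lie to the left of [h] like [v] and [c], giving three pairwise far points in
    a box of width 1 and height 2. The bound passes from the end of the first chain through [z] to
    the end of the second. *)
Lemma square_below (v h c d z : R * R) :
  near v h -> near h c -> near h d -> near c z -> near d z ->
  ~ near h z -> ~ near d c -> ~ near v c -> ~ near v d ->
  (v.1 < h.1 -> c.1 < h.1 -> h.1 < z.1 + 1)%Re.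
Proof.
move=> ? ? ? ? ? hz dc vc vd *; bounds.
case: (Rlt_le_dec h.1 (z.1 + 1)) => // ?.
have ? : (d.1 < h.1)%Re.
  by case: (Rlt_le_dec d.1 h.1) => // ?; split_far hz; split_far dc.
by split_far vc; split_far vd; split_far dc.
Qed.

(** Both chains gain more than 1 per step and [r] gains at most 1, while all three start together
    and end close to each other. The total lag over all n steps is therefore bounded, which yields
    the estimates required by [site_clash]. *)
Lemma no_oriented_config n j v u U q w t s p r g G d z y Y :
  config n j v u U q w t s p r g G d z y Y -> right_tips (v 0) (u 0) (U 0) -> False.
Proof.
move=> C tips0; have [j_gt0 j_lt] := cf_j C.
have Xc := cf_X C.
have [Xt Xs] := chain_run Xc tips0.
have n_gt0 : 0 < n by lia.
have [Yt Ys] : (forall i, i <= n -> right_tips (flip true false false (w i))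
      (flip true false false (t i)) (flip true false false (s i))) /\
    (forall i, i < n -> chain_step (flip true false false (w i))
      (flip true false false (t i)) (flip true false false (s i))
      (flip true false false (w i.+1)) (flip true false false (t i.+1))
      (flip true false false (s i.+1))).
  have Yc := cf_Y C.
  apply: (chain_run (chain_map (keeps_near_flip true false false) Yc)).
  have := chain_far_v Yc n_gt0; have := chain_far_uU Yc (leq0n n).
  have := chain_vU Yc (leq0n n); have := chain_uv Yc n_gt0; have := chain_Uv Yc n_gt0.
  rewrite /= (cf_wv C) (cf_tr C) -(cf_ur C) => sw uw vs us vw.
  by apply: (swapped_tips (chain_vu Xc _) (chain_vU Xc _) vs (chain_uv Xc _)
    (chain_Uv Xc _) uw sw vw us (cf_sU C) tips0).
have {}Yt i : i <= n -> [/\ (w i).2 < (t i).2, (w i).2 < (s i).2 & (s i).1 + 1 < (t i).1]%Re.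
  by move=> /Yt[].
have {}Ys i : i < n -> [/\ (w i).2 + 1 < (w i.+1).2, (t i).2 < (w i.+1).2 &
    (t i).2 + 1 < (t i.+1).2]%Re.
  by move=> /Ys[].
have vstep i : i < n -> ((v i).2 - 1 < (v i.+1).2 < (v i).2 + 1)%Re.
  move=> lt_in; have [_ _ h] := Xt _ (ltnW lt_in).
  have := chain_vu Xc (ltnW lt_in); have := chain_vU Xc (ltnW lt_in).
  by have := chain_uv Xc lt_in; have := chain_Uv Xc lt_in; move=> *; bounds; lra.
have wstep i : i < n -> ((w i).1 - 1 < (w i.+1).1 < (w i).1 + 1)%Re.
  move=> lt_in; have [_ _ h] := Yt _ (ltnW lt_in); have Yc := cf_Y C.
  have := chain_vu Yc (ltnW lt_in); have := chain_vU Yc (ltnW lt_in).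
  by have := chain_uv Yc lt_in; have := chain_Uv Yc lt_in; move=> *; bounds; lra.
have rstep i (lt_in : i < n) := near_bounds (cf_r C lt_in).
have rle1 : forall i k, i <= k <= n -> ((r k).1 + INR i <= (r i).1 + INR k)%Re.
  by apply: (@telescope_le (fun i => (r i).1)) => i /rstep; lra.
have rle2 : forall i k, i <= k <= n -> ((r k).2 + INR i <= (r i).2 + INR k)%Re.
  by apply: (@telescope_le (fun i => (r i).2)) => i /rstep; lra.
have uge : forall i k, i <= k <= n -> ((u i).1 + INR k <= (u k).1 + INR i)%Re.
  by apply: (@telescope_ge (fun i => (u i).1)) => i lt_in; case: (Xs i lt_in); lra.
have tge : forall i k, i <= k <= n -> ((t i).2 + INR k <= (t k).2 + INR i)%Re.
  by apply: (@telescope_ge (fun i => (t i).2)) => i lt_in; case: (Ys i lt_in); lra.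
have vle : forall i k, i <= k <= n -> ((v k).2 + INR i <= (v i).2 + INR k)%Re.
  by apply: (@telescope_le (fun i => (v i).2)) => i /vstep; lra.
have wle : forall i k, i <= k <= n -> ((w k).1 + INR i <= (w i).1 + INR k)%Re.
  by apply: (@telescope_le (fun i => (w i).1)) => i /wstep; lra.
have r01 := rstep 0 n_gt0.
have u01 := step_u (Xs 0 n_gt0); have [_ _ t01] := Ys 0 n_gt0.
have [h1 h2 h3] := Xt 0 (leq0n n); have [h4 h5 h6] := Yt 0 (leq0n n).
have rn := near_bounds (cf_unrn C).
(* The horizontal gap between [u i] and [r i] is 0 at the start, increases at every step and is at
   most 1 at the end. *)
have ur i : 0 < i < n -> ((r i).1 < (u i).1 < (r i).1 + 1)%Re.
  case/andP=> i_gt0 lt_in; have un : ((u i).1 + 1 < (u i.+1).1)%Re := step_u (Xs i lt_in).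
  have := uge 1 i; have := uge i.+1 n; have := rle1 1 i; have := rle1 i n.
  rewrite i_gt0 lt_in leqnn (ltnW lt_in) !S_INR /=.
  by do 4 move=> /(_ isT) ?; rewrite (cf_ur C) in u01; lra.
(* r i cannot pass below u i: neighbours on the path are close, so a change of side
   would bring r i near u i. *)
have below_ur i : 0 < i < n -> below (u i) (r i).
  elim: i => // i IHi lt_in.
  have := cf_far_ur C lt_in; have := ur _ lt_in.
  have lt_in' : i < n by lia.
  have := chain_vu (cf_X C) (ltnW (andP lt_in).2); rewrite /below.
  case: i IHi lt_in lt_in' => [_|i IHi] lt_in lt_in' v1u1 ur1 far1.
    have := cf_r1v0 C; have := cf_r1v1 C.
    have := chain_vu (cf_X C) (leq0n n); have := chain_uv (cf_X C) lt_in'.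
    have := chain_Uv (cf_X C) lt_in'; have := chain_vU (cf_X C) (leq0n n).
    have := step_uv (Xs 0 n_gt0); rewrite !(cf_ur C) in h1 h3 * => *; bounds.
    by split_far far1; do 2 match goal with H : ~ near (r 1) _ |- _ => split_far H end.
  have := IHi; rewrite lt_in' /= => /(_ isT); rewrite /below.
  have := rstep _ lt_in'; have := chain_Uv (cf_X C) lt_in'.
  have [_ _ ?] := Xt _ (ltnW lt_in').
  by move=> *; bounds; split_far far1; lra.
have nearC a b : near a b -> near b a by rewrite !nearP; lra.
have un_z : ((u n).1 < z.1 + 1)%Re.
  have [vn _ _] := Xt n (leqnn n).
  apply: (square_below (chain_vu (cf_X C) (leqnn n)) (cf_unrn C) (cf_und C)
    (nearC _ _ (cf_zrn C)) (cf_dz C) (cf_unz C) (cf_drn C) (cf_vnrn C) (cf_vnd C)) => //.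
  have := uge 1 n; have := rle1 0 n; rewrite /= leqnn n_gt0 (cf_ur C) in u01 *.
  by move=> /(_ isT) ? /(_ isT) ?; lra.
have := near_bounds (cf_dz C); have := near_bounds (cf_zrn C).
have := near_bounds (cf_ztn C); have := near_bounds (cf_und C).
have := near_bounds (chain_vu (cf_X C) (leqnn n)).
have := near_bounds (chain_vu (cf_Y C) (leqnn n)).
have le_j4 : j.+4 <= n <= n by lia.
have := uge _ _ le_j4; have := tge _ _ le_j4; have := vle _ _ le_j4.
have := wle _ _ le_j4; have := rle1 _ _ le_j4; have := rle2 _ _ le_j4.
have le_1j : 1 <= j <= n by lia.
have := uge _ _ le_1j; have := tge _ _ le_1j; have := wle _ _ le_1j.
have := rle1 _ _ le_1j; have := rle2 _ _ le_1j.
have in_n i : i < 4 -> i + j < n by lia.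
rewrite !S_INR /=.
have rs i (lt_i : i < 4) := rstep _ (in_n i lt_i).
have us i (lt_i : i < 4) : left_of (u (i + j)) (u (i + j).+1) := step_u (Xs _ (in_n i lt_i)).
have ts i (lt_i : i < 4) : below (t (i + j)) (t (i + j).+1) by case: (Ys _ (in_n i lt_i)).
rewrite /left_of /below in us ts.
have := (rs 0 isT); have := (rs 1 isT); have := (rs 2 isT); have := (rs 3 isT).
have := (us 0 isT); have := (us 1 isT); have := (us 2 isT); have := (us 3 isT).
have := (ts 0 isT); have := (ts 1 isT); have := (ts 2 isT); have := (ts 3 isT).
have := wstep 0 n_gt0; have := near_bounds (chain_vu (cf_Y C) (ltnW (in_n 0 isT))).
rewrite !addSn !add0n (cf_wv C) (cf_ur C) (cf_tr C) in u01 t01 h1 h3 *.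
move=> *.
have tr1 : left_of (t j) (r j.+1).
  by have := cf_tr1 C; rewrite /left_of => far; split_far far.
have jr : (forall i, i < 3 -> 0 < i + j < n) by move=> i; lia.
have gX i : i < 4 ->
  ((v (i + j)%N).2 + 1 < (g i).2 /\ (u (i + j).-1).1 < (g i).1 < (u (i + j)%N).1)%Re.
  move=> lt_i; have lt_pn : (i + j).-1 < n by lia.
  have E : (i + j).-1.+1 = i + j by lia.
  have := chain_uv (cf_X C) lt_pn; have := Xt _ (ltnW lt_pn); have := Xs _ lt_pn.
  have := chain_Uv (cf_X C) lt_pn; rewrite E => Uv [? ? ? ? _] [_ _ ?] uv.
  have [_ _ h] := Xt _ (ltnW (in_n i lt_i)).
  have vu := chain_vu (cf_X C) (ltnW (in_n i lt_i)).
  have vU := chain_vU (cf_X C) (ltnW (in_n i lt_i)).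
  apply: (g_above uv vu (cf_ug C lt_i) (cf_gu C lt_i) (cf_gv C lt_i)) => //.
    by bounds; lra.
  by bounds; lra.
have GX i : i < 3 -> [/\ (g i).1 + 1 < (g i.+1).1, (u (i + j)%N).2 + 1 < (G i).2,
    (g i).1 < (G i).1 < (g i.+1).1 & (g i).2 < (G i).2 /\ (g i.+1).2 < (G i).2]%Re.
  move=> lt_i; have lt_i4 := ltnW lt_i.
  have [? [? ?]] := gX i lt_i4; have [? [? ?]] := gX i.+1 lt_i.
  apply: (@G_above (u (i + j)) (v (i + j)) (v (i.+1 + j)) (g i) (g i.+1) (G i)) => //.
  - exact (chain_vu (cf_X C) (ltnW (in_n i lt_i4))).
  - exact (nearC _ _ (chain_uv (cf_X C) (in_n i lt_i4))).
  - exact (nearC _ _ (cf_gu C lt_i4)).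
  - exact (cf_ug C (lt_i : i.+1 < 4)).
  - exact (cf_gG C lt_i).
  - exact (cf_Gg C lt_i).
  - exact (cf_gg C lt_i).
  - exact (cf_uG C lt_i).
(* From the common start [r 0 = u 0 = t 0] the path has advanced by at most j in each coordinate at
   the site, and [u j] and [t j] by more than j in theirs. *)
apply: (@site_clash (fun i => u (i + j)) (fun i => v (i + j)) g G (fun i => t (i + j))
  (fun i => w (i + j)) (fun i => r (i + j)) y Y ((r 0).1 + INR j) ((r 0).2 + INR j)).
- exact (cf_r C (in_n 0 isT)).
- exact (cf_r C (in_n 1 isT)).
- exact (cf_ry C).
- exact (cf_yY C).
- by move=> i lt_i; exact (chain_vu (cf_X C) (ltnW (in_n i lt_i))).
- by move=> i lt_i; exact (nearC _ _ (cf_gu C lt_i)).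
- by move=> i lt_i; exact (cf_ug C (lt_i : i.+1 < 4)).
- exact (cf_gG C).
- exact (cf_Gg C).
- by move=> i lt_i; exact (chain_vu (cf_Y C) (ltnW (in_n i lt_i))).
- by move=> i lt_i; exact (us i (ltnW lt_i)).
- by move=> i /gX[_ []].
- by move=> i /gX[].
- move=> i lt_i; have := chain_Uv (cf_X C) (in_n i lt_i).
  by have [_ _ ?] := Xt _ (ltnW (in_n i lt_i)); move=> ?; bounds; rewrite !addSn; lra.
- by move=> i lt_i; have := vstep _ (in_n i lt_i); rewrite !addSn; lra.
- by move=> i /GX[].
- by move=> i /GX[].
- by move=> i /GX[].
- by move=> i /GX[].
- by move=> i lt_i; exact (ts i (ltnW lt_i)).
- move=> i lt_i; have := chain_Uv (cf_Y C) (in_n i lt_i).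
  by have [_ _ ?] := Yt _ (ltnW (in_n i lt_i)); move=> ?; bounds; rewrite !addSn; lra.
- by move=> i lt_i; have := wstep _ (in_n i lt_i); rewrite !addSn; lra.
- by rewrite add0n; lra.
- by rewrite add0n; lra.
- by rewrite !addSn !add0n; lra.
- by rewrite !addSn !add0n; lra.
- by rewrite !addSn !add0n; lra.
- exact (below_ur _ (jr 0 isT)).
- exact (below_ur _ (jr 2 isT)).
- exact tr1.
- exact (cf_GG C (isT : 0 < 2)).
- exact (cf_GG C (isT : 1 < 2)).
- exact (cf_G2u C).
- exact (cf_r0G C).
- exact (cf_r2G C).
- exact (cf_yr0 C).
- exact (cf_yr2 C).
- exact (cf_yt C).
- exact (cf_yG C).
- exact (cf_Yr C).
- exact (cf_YG C).
- exact (cf_Yt C).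
Qed.

(** One pair of opposite corners is far along one axis and the other pair along the other axis. The
    choice of the axis and the two directions give the eight symmetries. *)
Lemma orient (o u v U : R * R) :
  near o u -> near o U -> near u v -> near U v -> ~ near o v -> ~ near u U ->
  exists b sx sy,
    right_tips (flip b sx sy o) (flip b sx sy u) (flip b sx sy U).
Proof.
move=> ? ? ? ? ov uU; bounds.
split_far ov; split_far uU;
 [exists false, false, true | exists false, false, false | exists false, true, true |
  exists false, true, false | exists true, false, true | exists true, false, false |
  exists true, true, true | exists true, true, false];
 split; rewrite /flip /=; lra.
Qed.

Lemma no_config n j v u U q w t s p r g G d z y Y :
  ~ config n j v u U q w t s p r g G d z y Y.
Proof.
move=> C; have C1 := cf_X C; have n_gt0 : 0 < n by have [] := cf_j C; lia.
have [b [sx [sy tips]]] := orient (chain_vu C1 (leq0n n)) (chain_vU C1 (leq0n n))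
  (chain_uv C1 n_gt0) (chain_Uv C1 n_gt0) (chain_far_v C1 n_gt0) (chain_far_uU C1 (leq0n n)).
exact: no_oriented_config (config_map (keeps_near_flip b sx sy) C) tips.
Qed.

(** * Coordinates *)

Definition nearZ (T : Z) (a b : Z * Z) : bool :=
  (Z.abs (a.1 - b.1) <=? T)%ZZ && (Z.abs (a.2 - b.2) <=? T)%ZZ.

Section Points.
Variables (n : nat) (T : Z) (P Q : Z -> Prop).
Local Notation N := (Z.of_nat n).
Local Notation zz i := (Z.of_nat i).
Open Scope Z_scope.

(* Positions in the drawing, with all coordinates multiplied by T, so that
   adjacency means distance at most T.  The first and last indices are exceptional;
   pg, pG, py and pY are indexed by the corresponding index of u or r. *)
Definition pv (i : nat) : Z * Z :=
  match i with
  | 0%nat => (-1, -1) | 1%nat => (T, - T)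
  | _ => (zz i * (T + 1) + 2, zz i * (T - 1) - 3 * T - 6)
  end.
Definition pu (i : nat) : Z * Z :=
  match i with
  | 0%nat => (0, 0) | 1%nat => (T + 4, - 8)
  | _ => (zz i * (T + 1) + 3, zz i * (T - 1) - 2 * T - 6)
  end.
Definition pU (i : nat) : Z * Z :=
  match i with
  | 0%nat => (0, - T - 1) | 1%nat => (T + 4, - T - 9)
  | _ => (zz i * (T + 1) + 3, zz i * (T - 1) - 3 * T - 7)
  end.
Definition pq (i : nat) : Z * Z :=
  match i with
  | 0%nat | 1%nat => (4, - 2 * T - 1)
  | _ => (zz i * (T + 1) + 2, zz i * (T - 1) - 4 * T - 7)
  end.
Definition pw (i : nat) : Z * Z :=
  match i with
  | 0%nat => (-1, -1) | 1%nat => (- T, T)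
  | _ => (zz i * (T - 1) - 2 * T - 2, zz i * (T + 1) + 2)
  end.
Definition pt (i : nat) : Z * Z :=
  match i with
  | 0%nat => (0, 0) | 1%nat => (- 3, T + 4)
  | _ => if (i == n)%N then ((N - 1) * T - N - 2, (N + 1) * T - N - 6)
         else (zz i * (T - 1) - T - 2, zz i * (T + 1) + 3)
  end.
Definition ps (i : nat) : Z * Z :=
  match i with
  | 0%nat => (- T - 1, 0) | 1%nat => (- T - 4, T + 4)
  | _ => (zz i * (T - 1) - 2 * T - 3, zz i * (T + 1) + 3)
  end.
Definition pp (i : nat) : Z * Z :=
  match i with
  | 0%nat | 1%nat => (- 2 * T - 1, 4)
  | _ => (zz i * (T - 1) - 3 * T - 3, zz i * (T + 1) + 2)
  end.
Definition pr (i : nat) : Z * Z :=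
  if (i == n)%N then ((N - 1) * T + N + 3, (N - 1) * T - N - 6)
  else if (i.+1 == n)%N then ((N - 1) * T, (N - 1) * T - N - 7)
  else (zz i * T, zz i * T).
Definition pg (i : nat) : Z * Z :=
  (zz i * (T + 1) + 1, zz i * (T - 1) - 2 * T - 5).
Definition pG (i : nat) : Z * Z :=
  (zz i * (T + 1) + 2, zz i * (T - 1) - T - 5).
Definition pd : Z * Z := ((N + 1) * T - N - 2, (N - 1) * T - N - 6).
Definition pz : Z * Z := (N * T - N - 2, N * T - N - 6).
Definition py (i : nat) : Z * Z := (zz i * T + 1, zz i * T - 1).
Definition pY (i : nat) : Z * Z := (zz i * T + 1, zz i * T - T - 1).

(* Apart from z, the points of L(A) fall into two independent sets even_L and odd_L;
   P and Q are the sets of indices at which points G and Y are present. *)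
Inductive even_L : Z * Z -> Prop :=
| eL_v x of 2 <= x <= N : even_L (x * (T + 1) + 2, x * (T - 1) - 3 * T - 6)
| eL_q x of 2 <= x <= N : even_L (x * (T + 1) + 2, x * (T - 1) - 4 * T - 7)
| eL_w x of 2 <= x <= N : even_L (x * (T - 1) - 2 * T - 2, x * (T + 1) + 2)
| eL_p x of 2 <= x <= N : even_L (x * (T - 1) - 3 * T - 3, x * (T + 1) + 2)
| eL_g x of 2 <= x <= N - 6 : even_L (x * (T + 1) + 1, x * (T - 1) - 2 * T - 5)
| eL_o : even_L (-1, -1)
| eL_v1 : even_L (T, - T)
| eL_q1 : even_L (4, - 2 * T - 1)
| eL_w1 : even_L (- T, T)
| eL_p1 : even_L (- 2 * T - 1, 4)
| eL_r1 : even_L (T, T)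
| eL_rn2 : even_L ((N - 2) * T, (N - 2) * T)
| eL_rn : even_L ((N - 1) * T + N + 3, (N - 1) * T - N - 6)
| eL_d : even_L ((N + 1) * T - N - 2, (N - 1) * T - N - 6).

Inductive odd_L : Z * Z -> Prop :=
| oL_u x of 2 <= x <= N : odd_L (x * (T + 1) + 3, x * (T - 1) - 2 * T - 6)
| oL_U x of 2 <= x <= N : odd_L (x * (T + 1) + 3, x * (T - 1) - 3 * T - 7)
| oL_t x of 2 <= x < N : odd_L (x * (T - 1) - T - 2, x * (T + 1) + 3)
| oL_s x of 2 <= x <= N : odd_L (x * (T - 1) - 2 * T - 3, x * (T + 1) + 3)
| oL_G x of 2 <= x <= N - 6 & P x : odd_L (x * (T + 1) + 2, x * (T - 1) - T - 5)
| oL_r0 : odd_L (0, 0)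
| oL_u1 : odd_L (T + 4, - 8)
| oL_U0 : odd_L (0, - T - 1)
| oL_U1 : odd_L (T + 4, - T - 9)
| oL_s0 : odd_L (- T - 1, 0)
| oL_t1 : odd_L (- 3, T + 4)
| oL_s1 : odd_L (- T - 4, T + 4)
| oL_tn : odd_L ((N - 1) * T - N - 2, (N + 1) * T - N - 6)
| oL_r2 : odd_L (2 * T, 2 * T)
| oL_rn1 : odd_L ((N - 1) * T, (N - 1) * T - N - 7).

Lemma nearZ_sym a b : nearZ T a b = nearZ T b a.
Proof. by rewrite /nearZ; lia. Qed.

Lemma nearZP a1 a2 b1 b2 : nearZ T (a1, a2) (b1, b2) <->
  (- T <= a1 - b1 <= T /\ - T <= a2 - b2 <= T).
Proof. by rewrite /nearZ /=; lia. Qed.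

Hypothesis hN : 11 <= N.
Hypothesis hT : 10 * N + 100 <= T.

(** Linear arithmetic treats [x * T] as an atom and needs to be told that distinct multiples of [T]
    differ by at least [T]. The remaining terms of the coordinates are small compared with [T] by
    [hT]. *)
Lemma mulT_cases x y : x = y \/ (x + 1 <= y /\ x * T + T <= y * T) \/
  (y + 1 <= x /\ y * T + T <= x * T).
Proof.
have [?|[?|?]] : x = y \/ x + 1 <= y \/ y + 1 <= x by lia.
- by left.
- by right; left; split => //; nia.
- by right; right; split => //; nia.
Qed.

Lemma mulT_bounds x : 2 <= x <= N -> 2 * T <= x * T <= N * T.
Proof. by move=> ?; nia. Qed.

Lemma mulT_N : 11 * T <= N * T.
Proof. by nia. Qed.

Ltac index x := have ? : 2 * T <= x * T <= N * T by (apply: mulT_bounds; lia).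

Ltac order x y ab :=
  case: (mulT_cases x y) => [?|[[? ?]|[? ?]]]; [subst; first [lia | by case: ab] | lia | lia].

Ltac far_L ab :=
  try (by case: ab);
  have ? := mulT_N;
  lazymatch goal with
  | Hx : 2 <= ?x /\ _, Hy : 2 <= ?y /\ _ |- _ =>
      index x; index y; first [lia | order x y ab]
  | Hx : 2 <= ?x /\ _ |- _ => index x;
      first [lia | order x (Z.of_nat n) ab | order x 2 ab | order x (Z.of_nat n - 2) ab
            | order x (Z.of_nat n - 5) ab]
  | |- _ => lia
  end.

Lemma even_L_far a b : even_L a -> even_L b -> a <> b -> ~~ nearZ T a b.
Proof.
case=> [x ?|x ?|x ?|x ?|x ?|||||||||];
case=> [y ?|y ?|y ?|y ?|y ?|||||||||] ab; apply/negP => /nearZP [? ?].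
all: far_L ab.
Qed.

Lemma odd_L_far a b : odd_L a -> odd_L b -> a <> b -> ~~ nearZ T a b.
Proof.
case=> [x ?|x ?|x ?|x ?|x ? ?||||||||||];
case=> [y ?|y ?|y ?|y ?|y ? ?||||||||||] ab; apply/negP => /nearZP [? ?].
all: far_L ab.
Qed.

(** The points of R(B) apart from the two special ones. Only [Y] carries the condition [Q], because
    [y] stays far from every point of L(A) other than the special ones, whichever sites are
    chosen. *)
Inductive side_R : Z * Z -> Prop :=
| R_r x of 3 <= x <= N - 3 : side_R (x * T, x * T)
| R_y x of 6 <= x <= N - 9 : side_R (x * T + 1, x * T - 1)
| R_Y x of 6 <= x <= N - 9 & Q x : side_R (x * T + 1, x * T - T - 1).

Ltac far_LR :=
  have ? := mulT_N;
  lazymatch goal with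
  | Hx : 2 <= ?x /\ _, Hy : _ <= ?y <= N - _ |- _ =>
      index x; index y;
      case: (mulT_cases x y) => [?|[[? ?]|[? ?]]]; [subst| | ];
      first [lia | case: (mulT_cases x (y - 1)) => [?|[[? ?]|[? ?]]]; (try subst);
       first [lia | case: (mulT_cases x (y + 1)) => [?|[[? ?]|[? ?]]]; (try subst); [lia|lia|lia]]]
  | Hy : _ <= ?y <= N - _ |- _ => index y;
      case: (mulT_cases 3 y) => [?|[[? ?]|[? ?]]]; (try subst); first [lia |
      case: (mulT_cases y (Z.of_nat n - 3)) => [?|[[? ?]|[? ?]]]; (try subst);
      lia]
  end.

Lemma even_L_R a b : even_L a -> side_R b -> a <> ((N - 2) * T, (N - 2) * T) -> ~~ nearZ T a b.
Proof.
case=> [x ?|x ?|x ?|x ?|x ?|||||||||] [y ?|y ?|y ? ?] an2; apply/negP => /nearZP [? ?];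
  try by case: an2.
all: far_LR.
Qed.

(** The last hypothesis removes the only conflict in the drawing: [G] and [Y] of equal index are
    near each other. This is where A and B interact. *)
Lemma odd_L_R a b : odd_L a -> side_R b -> a <> (2 * T, 2 * T) ->
  (forall x, P x -> Q x -> a = (x * (T + 1) + 2, x * (T - 1) - T - 5) ->
             b = (x * T + 1, x * T - T - 1) -> False) -> ~~ nearZ T a b.
Proof.
case=> [x ?|x ?|x ?|x ?|x ? ?||||||||||] [y ?|y ?|y ? ?] a2 Gy; apply/negP => /nearZP [? ?];
  try by case: a2.
all: try (have ? : x <> y by move=> ?; subst; apply: (Gy y)).
all: far_LR.
Qed.

Lemma z_R b : side_R b -> ~~ nearZ T (N * T - N - 2, N * T - N - 6) b.
Proof. by case=> [y ?|y ?|y ? ?]; apply/negP => /nearZP [? ?]; far_LR. Qed.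

Lemma near_z a : even_L a \/ odd_L a -> nearZ T (N * T - N - 2, N * T - N - 6) a ->
  [\/ a = ((N - 1) * T + N + 3, (N - 1) * T - N - 6),
      a = ((N + 1) * T - N - 2, (N - 1) * T - N - 6) |
      a = ((N - 1) * T - N - 2, (N + 1) * T - N - 6)].
Proof.
case=> [[x ?|x ?|x ?|x ?|x ?|||||||||]|[x ?|x ?|x ?|x ?|x ? ?||||||||||]] /nearZP [? ?].
all: first [by constructor | exfalso].
all: far_L a.
Qed.

Definition in_L a := [\/ even_L a, odd_L a | a = pz].

Lemma near_s1 a : in_L a -> nearZ T (2 * T, 2 * T) a -> a <> (2 * T, 2 * T) -> a = (T, T).
Proof.
case=> [|oa na ne|->].
- by case=> [x ?|x ?|x ?|x ?|x ?|||||||||] // /nearZP [? ?] ne; exfalso; far_L ne.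
- by case/negP: (odd_L_far oL_r2 oa (nesym ne)).
- by move=> /nearZP [? ?]; have ? := mulT_N; lia.
Qed.

Lemma near_s2 a : in_L a -> nearZ T ((N - 2) * T, (N - 2) * T) a ->
  a <> ((N - 2) * T, (N - 2) * T) -> a = ((N - 1) * T, (N - 1) * T - N - 7).
Proof.
case=> [ea na ne||->].
- by case/negP: (even_L_far eL_rn2 ea (nesym ne)).
- by case=> [x ?|x ?|x ?|x ?|x ? ?||||||||||] // /nearZP [? ?] ne; exfalso; far_L ne.
- by move=> /nearZP [? ?]; have ? := mulT_N; lia.
Qed.

Lemma near_s1_R b : side_R b -> nearZ T (2 * T, 2 * T) b -> b = (3 * T, 3 * T).
Proof.
case=> [y ?|y ?|y ? ?] /nearZP [? ?]; case: (mulT_cases 3 y) => [?|[[? ?]|[? ?]]]; try lia.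
by subst.
Qed.

Lemma near_s2_R b : side_R b -> nearZ T ((N - 2) * T, (N - 2) * T) b ->
  b = ((N - 3) * T, (N - 3) * T).
Proof.
case=> [y ?|y ?|y ? ?] /nearZP [? ?]; case: (mulT_cases y (N - 3)) => [?|[[? ?]|[? ?]]]; try lia.
by subst.
Qed.

(** R(B) is bipartite by parity: sites are odd, so [y] hangs from an even-indexed [r] and joins the
    class of the odd-indexed ones, and [Y] joins the other class. *)
Inductive even_R : Z * Z -> Prop :=
| eR_r k of 2 <= 2 * k + 1 <= N - 2 : even_R ((2 * k + 1) * T, (2 * k + 1) * T)
| eR_y k of 6 <= 2 * k <= N - 9 : even_R (2 * k * T + 1, 2 * k * T - 1).

Inductive odd_R : Z * Z -> Prop :=
| oR_r k of 2 <= 2 * k <= N - 2 : odd_R (2 * k * T, 2 * k * T)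
| oR_Y k of 6 <= 2 * k <= N - 9 : odd_R (2 * k * T + 1, 2 * k * T - T - 1).

Ltac far_R ab :=
  lazymatch goal with
  | _ : _ <= _ * ?x + 1 <= _, _ : _ <= _ * ?y + 1 <= _ |- _ =>
    case: (mulT_cases x y) => [?|[[? ?]|[? ?]]]; (try subst); first [by case: ab | lia]
  | _ : _ <= _ * ?x + 1 <= _, _ : _ <= _ * ?y <= _ |- _ =>
    case: (mulT_cases x y) => [?|[[? ?]|[? ?]]]; (try subst); first [by case: ab | lia]
  | _ : _ <= _ * ?x <= _, _ : _ <= _ * ?y <= _ |- _ =>
    case: (mulT_cases x y) => [?|[[? ?]|[? ?]]]; (try subst); first [by case: ab | lia]
  end.

Lemma even_R_far a b : even_R a -> even_R b -> a <> b -> ~~ nearZ T a b.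
Proof. by case=> [x ?|x ?] [y ?|y ?] ab; apply/negP => /nearZP [? ?]; far_R ab. Qed.

Lemma odd_R_far a b : odd_R a -> odd_R b -> a <> b -> ~~ nearZ T a b.
Proof. by case=> [x ?|x ?] [y ?|y ?] ab; apply/negP => /nearZP [? ?]; far_R ab. Qed.
End Points.

(** * The point lists of the two sides *)

Definition upto T (f : nat -> T) (m : nat) : seq T := [seq f i | i <- iota 0 m].

Lemma mem_upto (T : eqType) (f : nat -> T) m i : i < m -> f i \in upto f m.
Proof. by move=> lt_im; apply: map_f; rewrite mem_iota. Qed.

Section Members.
Variables (n : nat) (T : Z) (P Q : Z -> Prop).

Definition listL (js : seq nat) : seq (Z * Z) :=
  upto (pv T) n.+1 ++ upto (pu T) n.+1 ++ upto (pU T) n.+1 ++ upto (pq T) n.+1 ++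
  upto (pw T) n.+1 ++ upto (pt n T) n.+1 ++ upto (ps T) n.+1 ++ upto (pp T) n.+1 ++
  [:: pr n T 0; pr n T 1; pr n T 2; pr n T (n - 2); pr n T (n - 1); pr n T n;
      pd n T; pz n T] ++
  [seq pg T (k + j) | j <- js, k <- iota 0 4] ++
  [seq pG T (k + j) | j <- js, k <- iota 0 3].

Definition listR (js : seq nat) : seq (Z * Z) :=
  [seq pr n T i | i <- iota 2 (n - 3)] ++
  [seq py T j.+1 | j <- js] ++ [seq pY T j.+1 | j <- js].

Lemma in_pv i : i <= n -> even_L n T (pv T i).
Proof. by case: i => [|[|i]] le_in; constructor; lia. Qed.

Lemma in_pq i : i <= n -> even_L n T (pq T i).
Proof. by case: i => [|[|i]] le_in; constructor; lia. Qed.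

Lemma in_pw i : i <= n -> even_L n T (pw T i).
Proof. by case: i => [|[|i]] le_in; constructor; lia. Qed.

Lemma in_pp i : i <= n -> even_L n T (pp T i).
Proof. by case: i => [|[|i]] le_in; constructor; lia. Qed.

Lemma in_pu i : i <= n -> odd_L n T P (pu T i).
Proof. by case: i => [|[|i]] le_in; constructor; lia. Qed.

Lemma in_pU i : i <= n -> odd_L n T P (pU T i).
Proof. by case: i => [|[|i]] le_in; constructor; lia. Qed.

Lemma in_ps i : i <= n -> odd_L n T P (ps T i).
Proof. by case: i => [|[|i]] le_in; constructor; lia. Qed.

Lemma in_pt i : i <= n -> odd_L n T P (pt n T i).
Proof.
case: i => [|[|i]] le_in; [exact: oL_r0|exact: oL_t1|rewrite /pt].
by case: (i.+2 =P n) => ?; [exact: oL_tn | apply: oL_t; lia].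
Qed.

Lemma pr_mid i : i.+1 < n -> pr n T i = (Z.of_nat i * T, Z.of_nat i * T)%ZZ.
Proof. by move=> ?; rewrite /pr; case: (i =P n) => [|_]; [lia|case: (i.+1 =P n) => //; lia]. Qed.

Lemma pr_pred : 0 < n ->
  pr n T n.-1 = ((Z.of_nat n - 1) * T, (Z.of_nat n - 1) * T - Z.of_nat n - 7)%ZZ.
Proof.
by move=> ?; rewrite /pr; case: (n.-1 =P n) => [|_]; [lia|case: (n.-1.+1 =P n) => //; lia].
Qed.

Lemma in_listL js a : 10 < n -> (forall j, j \in js -> 2 <= j <= n - 10) ->
  (forall j k, j \in js -> k < 3 -> P (Z.of_nat (k + j))) ->
  a \in listL js -> in_L n T P a.
Proof.
move=> n_gt js_n js_P; rewrite !mem_cat.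
do 8 (case/orP; [move=> /mapP[i]; rewrite mem_iota add0n => /andP[_ lt_i] -> ;
  first [by apply: Or31; auto using in_pv, in_pq, in_pw, in_pp |
         by apply: Or32; auto using in_pu, in_pU, in_pt, in_ps] | ]).
case/orP.
  have E i : i.+1 < n -> pr n T i = (Z.of_nat i * T, Z.of_nat i * T)%ZZ by exact: pr_mid.
  rewrite !inE subn1 pr_pred ?(E 0) ?(E 1) ?(E 2) ?(E (n - 2)) /pr ?eqxx; try lia.
  case/or4P=> [/eqP->|/eqP->|/eqP->|/or4P[/eqP->|/eqP->|/eqP->|/orP[]/eqP->]].
  - exact: (Or32 _ _ (oL_r0 n T P)).
  - by rewrite Z.mul_1_l; exact: (Or31 _ _ (eL_r1 n T)).
  - exact: (Or32 _ _ (oL_r2 n T P)).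
  - by rewrite Nat2Z.inj_sub; [exact: (Or31 _ _ (eL_rn2 n T)) | lia].
  - exact: (Or32 _ _ (oL_rn1 n T P)).
  - exact: (Or31 _ _ (eL_rn n T)).
  - exact: (Or31 _ _ (eL_d n T)).
  - exact: Or33.
case/orP=> /allpairsP[p [js_p]]; have ? := js_n _ js_p; rewrite mem_iota => ? ->.
  by apply: Or31; apply: eL_g; lia.
by apply: Or32; apply: oL_G; [lia | apply: js_P].
Qed.

Definition sideR (a : Z * Z) : Prop :=
  [\/ a = pr n T 2, a = pr n T (n - 2) | side_R n T Q a].

Lemma in_listR js a : 10 < n -> (forall j, j \in js -> 5 <= j <= n - 10) ->
  (forall j, j \in js -> Q (Z.of_nat j.+1)) ->
  a \in listR js -> sideR a.
Proof.
move=> n_gt js_n js_Q.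
rewrite !mem_cat => /orP[/mapP[i] | /orP[] /mapP[j js_j ->]]; try have ? := js_n j js_j.
- rewrite mem_iota => ? ->.
  case: (i =P 2) => [->|?]; first exact: Or31.
  case: (i =P n - 2) => [->|?]; first exact: Or32.
  by rewrite pr_mid; [apply: Or33; apply: R_r|]; lia.
- by apply: Or33; apply: R_y; lia.
- by apply: Or33; apply: R_Y; [lia | apply: js_Q].
Qed.

Lemma in_listR_parity js a : 10 < n ->
  (forall j, j \in js -> odd j && (5 <= j <= n - 10)) ->
  a \in listR js -> even_R n T a \/ odd_R n T a.
Proof.
move=> n_gt js_n.
have half i : (Z.of_nat i = 2 * Z.of_nat i./2 + Z.of_nat (odd i))%ZZ by lia.
rewrite !mem_cat => /orP[/mapP[i] | /orP[] /mapP[j /js_n ? ->]].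
- rewrite mem_iota => ? ->; rewrite pr_mid; last by lia.
  rewrite (half i); case oi: (odd i) => /=; [left|right; rewrite Z.add_0_r].
    by apply: eR_r; have := half i; lia.
  by apply: oR_r; have := half i; lia.
- left; have E : (Z.of_nat j.+1 = 2 * Z.of_nat j.+1./2)%ZZ by lia.
  by rewrite /py E; apply: eR_y; lia.
- right; have E : (Z.of_nat j.+1 = 2 * Z.of_nat j.+1./2)%ZZ by lia.
  by rewrite /pY E; apply: oR_Y; lia.
Qed.

End Members.

(** * Gluing two point graphs *)

Definition adjZ (T : Z) (a b : Z * Z) : bool := (a != b) && nearZ T a b.

Lemma adjZ_sym T : symmetric (adjZ T).
Proof. by move=> a b; rewrite /adjZ eq_sym /nearZ; congr (_ && _); lia. Qed.

Definition pgraph (T : Z) (l : seq (Z * Z)) : graph :=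
  @Graph (seq_sub l) (fun a b => adjZ T (val a) (val b)).

Definition plgraph (T : Z) (l : seq (Z * Z)) k (s : 'I_k -> Z * Z)
    (sl : forall i, s i \in l) : lgraph k :=
  @LGraph k (pgraph T l) (fun i => SeqSub (sl i)).

Lemma simple_plgraph T l k s (sl : forall i : 'I_k, s i \in l) :
  simple_graph (plgraph T sl).
Proof.
split=> [a b|a]; first exact: adjZ_sym.
by rewrite /= /adjZ eqxx.
Qed.

Section Glue.
Variables (T : Z) (lL lR : seq (Z * Z)) (k : nat) (s : 'I_k -> Z * Z).
Variables (sL : forall i, s i \in lL) (sR : forall i, s i \in lR).
Hypothesis lLR : forall a, a \in lL -> a \in lR -> exists i, a = s i.

Local Notation H := (glue (plgraph T sL) (plgraph T sR)).

Definition gpt (x : gV H) : Z * Z :=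
  match x with inl a => val a | inr w => val (val w) end.

(** Every edge of the glued graph comes from one of the sides, so nearness across the sides does not
    count. *)
Definition gadjZ (a b : Z * Z) : bool :=
  adjZ T a b && ((a \in lL) && (b \in lL) || (a \in lR) && (b \in lR)).

Lemma gpt_inr_notin (w : {w : gV (plgraph T sR) | w \notin codom (@lab k (plgraph T sR))}) :
  val (val w) \notin lL.
Proof.
apply/negP => wL; have [i Ei] := lLR wL (ssvalP (val w)).
case/negP: (valP w); apply/codomP; exists i; exact: val_inj.
Qed.

Lemma gpt_mem x : (gpt x \in lL) || (gpt x \in lR).
Proof. by case: x => [a|w]; rewrite ?(ssvalP a) // (ssvalP (val w)) orbT. Qed.

Lemma gpt_inj : injective gpt.
Proof.
move=> [a|w] [b|w'] /= E.
- by congr inl; apply: val_inj.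
- by case/negP: (gpt_inr_notin w'); rewrite -[val (val w')]E; exact: ssvalP.
- by case/negP: (gpt_inr_notin w); rewrite [val (val w)]E; exact: ssvalP.
- by congr inr; do 2 apply: val_inj.
Qed.

Lemma gpt_surj a : a \in lL \/ a \in lR -> exists x, gpt x = a.
Proof.
case=> [aL|aR]; first by exists (inl (SeqSub aL)).
case: (boolP (a \in lL)) => [aL|naL]; first by exists (inl (SeqSub aL)).
have w : (SeqSub aR : gV (plgraph T sR)) \notin codom (@lab k (plgraph T sR)).
  apply/negP => /codomP[i Ei]; case/negP: naL.
  by have -> : a = s i by have := congr1 val Ei.
by exists (inr (Sub (SeqSub aR) w)).
Qed.

Lemma gpt_adj x y : @gadj H x y = gadjZ (gpt x) (gpt y).
Proof.
rewrite /gadjZ; case: x y => [a|w] [b|w'] /=.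
- rewrite !(ssvalP a) !(ssvalP b) andbT /=.
  (* An edge of the right side between two special vertices is already an edge of the left side,
     both being read off the same points. *)
  case: (boolP (adjZ T _ _)) => //= nab; apply/negbTE/negP => /existsP[i /existsP[j /and3P[]]].
  by move=> /eqP Ea /eqP Eb; rewrite -Ea -Eb /= in nab; rewrite (negPf nab).
- rewrite (negPf (gpt_inr_notin w')) andbF /= (ssvalP (val w')) andbT.
  apply/existsP/andP => [[i /andP[/eqP <- /= ->]]|[ab aR]]; first by rewrite sR.
  have [i Ei] := lLR (ssvalP a) aR; exists i.
  by apply/andP; split; [apply/eqP/val_inj | rewrite /= -Ei].
- rewrite (negPf (gpt_inr_notin w)) /= (ssvalP (val w)) /=.
  apply/existsP/andP => [[i /andP[/eqP <- /= ->]]|[ab bR]]; first by rewrite sR.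
  have [i Ei] := lLR (ssvalP b) bR; exists i.
  by apply/andP; split; [apply/eqP/val_inj | rewrite /= -Ei].
- by rewrite (ssvalP (val w)) (ssvalP (val w')) orbT andbT.
Qed.

Lemma gadjZ_sym : symmetric gadjZ.
Proof.
by move=> a b; rewrite /gadjZ adjZ_sym [(b \in lL) && _]andbC [(b \in lR) && _]andbC.
Qed.

Lemma card_glue : #|gV H| <= size lL + size lR.
Proof.
pose f x := gpt x; rewrite -size_cat cardE -(size_map gpt).
apply: uniq_leq_size; first by rewrite (map_inj_uniq gpt_inj) enum_uniq.
by move=> a /mapP[x _ ->]; rewrite mem_cat gpt_mem.
Qed.

End Glue.

(** * The disjoint case *)

Section Cross.
Variables (n : nat) (T : Z) (P Q : Z -> Prop).
Hypothesis hN : (11 <= Z.of_nat n)%ZZ.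
Hypothesis hT : (10 * Z.of_nat n + 100 <= T)%ZZ.

Lemma pr_2 : pr n T 2 = (2 * T, 2 * T)%ZZ.
Proof. by rewrite pr_mid //; lia. Qed.

Lemma pr_n2 : pr n T (n - 2) = ((Z.of_nat n - 2) * T, (Z.of_nat n - 2) * T)%ZZ.
Proof. by rewrite pr_mid; [rewrite Nat2Z.inj_sub //|]; lia. Qed.

Lemma in_L_side_R_far a b : in_L n T P a -> side_R n T Q b ->
  a <> pr n T 2 -> a <> pr n T (n - 2) -> (forall x, P x -> Q x -> False) ->
  ~~ nearZ T a b.
Proof.
rewrite pr_2 pr_n2; case=> [ea|oa|->] sb a2 an2 PQ; last exact (z_R hN hT sb).
- exact: (even_L_R hN hT ea sb an2).
- by apply: (odd_L_R hN hT oa sb a2) => x Px Qx _ _; apply: (PQ x).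
Qed.

Lemma in_L_side_R a : in_L n T P a -> side_R n T Q a ->
  a = pr n T 2 \/ a = pr n T (n - 2).
Proof.
(* A point is near itself, so the separation lemmas for the two sides also show that a common point
   is special. *)
have na : nearZ T a a by rewrite /nearZ; lia.
case: (a =P pr n T 2) => [|a2]; first by left.
case: (a =P pr n T (n - 2)) => [|an2]; first by right.
rewrite pr_2 in a2; rewrite pr_n2 in an2.
case=> [ea|oa|az] sa.
- by case/negP: (even_L_R hN hT ea sa an2).
- suff : ~~ nearZ T a a by rewrite na.
  by apply: (odd_L_R hN hT oa sa a2) => x _ _ -> []; lia.
- by have := z_R hN hT sa; rewrite -/(pz n T) -az na.
Qed.

Lemma triangle_z a b : even_L n T a \/ odd_L n T P a -> even_L n T b \/ odd_L n T P b ->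
  nearZ T (pz n T) a -> nearZ T (pz n T) b -> nearZ T a b -> a = b.
Proof.
have ? := mulT_N hN hT.
move=> ka kb na nb; case: (near_z hN hT ka na) => ->;
case: (near_z hN hT kb nb) => -> /nearZP[? ?]; first [by [] | lia].
Qed.

(** The classes [even_L] and [odd_L] are independent, so a triangle would have to contain [z]; but
    the neighbours of [z] are pairwise far. *)
Lemma triangle_L a b c : in_L n T P a -> in_L n T P b -> in_L n T P c ->
  a <> b -> b <> c -> a <> c -> nearZ T a b -> nearZ T b c -> nearZ T a c -> False.
Proof.
move=> La Lb Lc ab bc ac nab nbc nac.
have E x y : even_L n T x -> even_L n T y -> x <> y -> nearZ T x y -> False.
  by move=> ex ey xy; apply/negP; apply: (even_L_far hN hT ex ey xy).
have O x y : odd_L n T P x -> odd_L n T P y -> x <> y -> nearZ T x y -> False.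
  by move=> ox oy xy; apply/negP; apply: (odd_L_far hN hT ox oy xy).
have nba := nearZ_sym T a b; have ncb := nearZ_sym T b c; have nca := nearZ_sym T a c.
rewrite nab in nba; rewrite nbc in ncb; rewrite nac in nca.
case: La Lb Lc => [ea|oa|az] [eb|ob|bz] [ec|oc|cz]; subst;
  try solve [eauto 2 | by case: ab | by case: bc | by case: ac];
  first [by apply: ab; apply: triangle_z; auto | by apply: bc; apply: triangle_z; auto
        | by apply: ac; apply: triangle_z; auto].
Qed.

Lemma triangle_R a b c : even_R n T a \/ odd_R n T a -> even_R n T b \/ odd_R n T b ->
  even_R n T c \/ odd_R n T c ->
  a <> b -> b <> c -> a <> c -> nearZ T a b -> nearZ T b c -> nearZ T a c -> False.
Proof.
move=> La Lb Lc ab bc ac nab nbc nac.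
have E x y : even_R n T x -> even_R n T y -> x <> y -> nearZ T x y -> False.
  by move=> ex ey xy; apply/negP; apply: (even_R_far hN hT ex ey xy).
have O x y : odd_R n T x -> odd_R n T y -> x <> y -> nearZ T x y -> False.
  by move=> ox oy xy; apply/negP; apply: (odd_R_far hN hT ox oy xy).
by case: La Lb Lc => [ea|oa] [eb|ob] [ec|oc]; eauto 2.
Qed.
End Cross.

Definition spec (n : nat) (T : Z) (i : 'I_2) : Z * Z :=
  if i == 0 :> nat then pr n T 2 else pr n T (n - 2).

(** Oddness gives the two colour classes of R(B) and separates [Y] from the vertices [G] of other
    sites. The range keeps the decorations clear of the exceptional indices at both ends. *)
Definition site (n j : nat) : bool := odd j && (5 <= j <= n - 10).

Section Instance.
Variables (n : nat) (T : Z) (jA jB : seq nat).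
Hypothesis hn : 10 < n.
Hypothesis hT : (10 * Z.of_nat n + 100 <= T)%ZZ.
Hypothesis okA : {subset jA <= site n}.
Hypothesis okB : {subset jB <= site n}.

Let hN : (11 <= Z.of_nat n)%ZZ. Proof. by clear -hn; lia. Qed.
Let P x := exists j k, [/\ j \in jA, k < 3 & x = Z.of_nat (k + j)].
Let Q x := exists2 j, j \in jB & x = Z.of_nat j.+1.

Lemma spec_L js i : spec n T i \in listL n T js.
Proof. by rewrite /spec; case: eqP => _; rewrite !mem_cat !inE !eqxx ?orbT. Qed.

Lemma spec_R js i : spec n T i \in listR n T js.
Proof.
rewrite /spec /listR mem_cat; apply/orP; left.
by case: eqP => _; apply: map_f; rewrite mem_iota; lia.
Qed.

Lemma spec_inj : injective (spec n T).
Proof.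
have ? := mulT_N hN hT.
move=> i j; rewrite /spec pr_2 // pr_n2 //.
by case: eqP => Ei; case: eqP => Ej /(congr1 fst); cbn [fst] => ?;
apply: ord_inj; move: (ltn_ord i) (ltn_ord j); lia.
Qed.

Lemma mem_L a : a \in listL n T jA -> in_L n T P a.
Proof.
apply: in_listL => // [j /okA|j k jA_j lt_k]; last by exists j, k.
by rewrite unfold_in /site; lia.
Qed.

Lemma mem_R a : a \in listR n T jB -> sideR n T Q a.
Proof.
apply: in_listR => // [j /okB|j jB_j]; last by exists j.
by rewrite unfold_in /site; lia.
Qed.

Lemma spec0 : pr n T 2 = spec n T ord0. Proof. by []. Qed.
Lemma spec1 : pr n T (n - 2) = spec n T (lift ord0 ord0). Proof. by []. Qed.

Lemma common_spec a : a \in listL n T jA -> a \in listR n T jB -> exists i, a = spec n T i.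
Proof.
move=> /mem_L La /mem_R[->|->|Ra]; [by exists ord0|by exists (lift ord0 ord0)|].
case: (in_L_side_R hN hT La Ra) => ->; [by exists ord0|by exists (lift ord0 ord0)].
Qed.

Local Notation H := (glue (plgraph T (spec_L jA)) (plgraph T (spec_R jB))).
Local Notation gp := (@gpt T (listL n T jA) (listR n T jB) 2 (spec n T)
  (spec_L jA) (spec_R jB)).
Local Notation adj := (gadjZ T (listL n T jA) (listR n T jB)).

Lemma gp_adj (x y : gV H) : gadj x y = adj (gp x) (gp y).
Proof. exact: gpt_adj common_spec x y. Qed.

Lemma adj_far a b : a \in listL n T jA -> a \notin listR n T jB ->
  b \notin listL n T jA -> adj a b = false.
Proof. by move=> aL aR bL; rewrite /gadjZ (negPf aR) (negPf bL) andbF /= andbF. Qed.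

Lemma disjoint_adj a b : (forall j, j \in jA -> j \in jB -> False) ->
  a \in listL n T jA \/ a \in listR n T jB -> b \in listL n T jA \/ b \in listR n T jB ->
  a <> b -> nearZ T a b -> adj a b.
Proof.
move=> dAB.
have PQ x : P x -> Q x -> False.
  case=> j [k [jAj k3 ->]] [i jBi] E.
  have := okA jAj; have := okB jBi; rewrite !unfold_in /site => ? ?.
  (* [Y] of site i has index i + 1 and the [G] of site j have indices j, j + 1, j + 2; both sites
     are odd, so the indices agree only for i = j. *)
  have Eij : i = j by lia.
  by apply: (dAB j) => //; rewrite -Eij.
have cross x y : x \in listL n T jA -> x \notin listR n T jB -> y \in listR n T jB ->
    y \notin listL n T jA -> nearZ T x y -> False.
  move=> xL xR yR yL; apply/negP.
  case: (mem_R yR) => [E|E|sy]; try by case/negP: yL; rewrite E ?spec0 ?spec1 spec_L.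
  by apply: (in_L_side_R_far hN hT (mem_L xL) sy) => // E;
    case/negP: xR; rewrite E ?spec0 ?spec1 spec_R.
move=> ia ib ab nab; rewrite /gadjZ /adjZ nab (introF eqP ab) /=.
move: ia ib.
case aL: (a \in listL _ _ _); case bL: (b \in listL _ _ _) => //=;
case aR: (a \in listR _ _ _); case bR: (b \in listR _ _ _) => //= ia ib; try by case: ia; case: ib.
- by case: (cross a b); rewrite ?aL ?aR ?bL ?bR.
- by case: (cross b a); rewrite ?aL ?aR ?bL ?bR // nearZ_sym.
Qed.

Lemma no_triangle a b c : adj a b -> adj b c -> adj a c -> False.
Proof.
have tri_L : a \in listL n T jA -> b \in listL n T jA -> c \in listL n T jA ->
    adjZ T a b -> adjZ T b c -> adjZ T a c -> False.
  move=> /mem_L La /mem_L Lb /mem_L Lc /andP[/eqP ? ?] /andP[/eqP ? ?] /andP[/eqP ? ?].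
  exact: (triangle_L hN hT La Lb Lc).
have tri_R : a \in listR n T jB -> b \in listR n T jB -> c \in listR n T jB ->
    adjZ T a b -> adjZ T b c -> adjZ T a c -> False.
  have par x : x \in listR n T jB -> even_R n T x \/ odd_R n T x.
    apply: in_listR_parity => // j /okB.
  move=> /par La /par Lb /par Lc /andP[/eqP ? ?] /andP[/eqP ? ?] /andP[/eqP ? ?].
  exact: (triangle_R hN hT La Lb Lc).
rewrite /gadjZ => /andP[nab ab] /andP[nbc bc] /andP[nac ac].
(* Two of the three edges come from the same side, and together they cover all three vertices. *)
have /orP[/and3P[aL bL cL]|/and3P[aR bR cR]] :
    [&& a \in listL n T jA, b \in listL n T jA & c \in listL n T jA] ||
    [&& a \in listR n T jB, b \in listR n T jB & c \in listR n T jB].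
- by move: ab bc ac; do 3 case: (_ \in listL _ _ _); do 3 case: (_ \in listR _ _ _).
- exact: (tri_L aL bL cL).
- exact: (tri_R aR bR cR).
Qed.

Lemma glue_triangle_free : triangle_free H.
Proof.
move=> [x [y [z [_ _ _ /and3P[]]]]]; rewrite !gp_adj; exact: no_triangle.
Qed.

Lemma glue_realised : (forall j, j \in jA -> j \in jB -> False) -> unit_square_graph H.
Proof.
move=> dAB; exists (fun x => (IZR (gp x).1 / IZR T, IZR (gp x).2 / IZR T)%Re).
have T0 : (0 < IZR T)%Re by apply: IZR_lt; lia.
have scale (a b : Z) : (Rabs (IZR a / IZR T - IZR b / IZR T) <= 1)%Re <->
    (Z.abs (a - b) <= T)%ZZ.
  have -> : (IZR a / IZR T - IZR b / IZR T = IZR (a - b) * / IZR T)%Re.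
    by rewrite minus_IZR; field; lra.
  rewrite Rabs_mult (Rabs_right (/ IZR T)) -?abs_IZR; last first.
    by apply: Rle_ge; apply: Rlt_le; apply: Rinv_0_lt_compat.
  split=> [le1|/IZR_le le1].
    apply: le_IZR; apply: (Rmult_le_reg_r (/ IZR T)); first exact: Rinv_0_lt_compat.
    by rewrite Rinv_r; [exact: le1 | lra].
  by apply: (Rmult_le_reg_r (IZR T)) => //; rewrite Rmult_assoc Rinv_l; lra.
split=> [x y [/= E1 E2]|x y].
  apply: (gpt_inj common_spec).
  have inj (a b : Z) : (IZR a / IZR T = IZR b / IZR T)%Re -> a = b.
    move=> E; apply: eq_IZR; apply: (Rmult_eq_reg_r (/ IZR T)) => //.
    by apply: Rinv_neq_0_compat; lra.
  by rewrite [LHS]surjective_pairing (inj _ _ E1) (inj _ _ E2) -surjective_pairing.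
rewrite gp_adj /= !scale; split=> [/andP[/andP[/eqP ne /andP[? ?]] _]|[ne [? ?]]].
  by split=> [E|]; [apply: ne; rewrite E | lia].
have mem u : gp u \in listL n T jA \/ gp u \in listR n T jB by apply/orP; exact: gpt_mem.
apply: disjoint_adj; auto; last by rewrite /nearZ; lia.
by move=> E; apply: ne; apply: (gpt_inj common_spec).
Qed.
End Instance.

Section Mem.
Variables (n : nat) (T : Z) (js : seq nat).
Hypothesis hn : 10 < n.
Implicit Types i j k : nat.

Lemma pv_L i : i <= n -> pv T i \in listL n T js.
Proof. by move=> ?; rewrite /listL !mem_cat mem_upto ?orbT. Qed.
Lemma pu_L i : i <= n -> pu T i \in listL n T js.
Proof. by move=> ?; rewrite /listL !mem_cat mem_upto ?orbT. Qed.
Lemma pU_L i : i <= n -> pU T i \in listL n T js.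
Proof. by move=> ?; rewrite /listL !mem_cat (mem_upto (pU T)) ?orbT. Qed.
Lemma pq_L i : i <= n -> pq T i \in listL n T js.
Proof. by move=> ?; rewrite /listL !mem_cat (mem_upto (pq T)) ?orbT. Qed.
Lemma pw_L i : i <= n -> pw T i \in listL n T js.
Proof. by move=> ?; rewrite /listL !mem_cat (mem_upto (pw T)) ?orbT. Qed.
Lemma pt_L i : i <= n -> pt n T i \in listL n T js.
Proof. by move=> ?; rewrite /listL !mem_cat (mem_upto (pt n T)) ?orbT. Qed.
Lemma ps_L i : i <= n -> ps T i \in listL n T js.
Proof. by move=> ?; rewrite /listL !mem_cat (mem_upto (ps T)) ?orbT. Qed.
Lemma pp_L i : i <= n -> pp T i \in listL n T js.
Proof. by move=> ?; rewrite /listL !mem_cat (mem_upto (pp T)) ?orbT. Qed.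

Lemma pr_L i : i \in [:: 0; 1; 2; n - 2; n - 1; n] -> pr n T i \in listL n T js.
Proof.
rewrite !inE => H; do ?[case/orP: H => H]; move/eqP: H => ->;
by rewrite /listL !mem_cat !inE !eqxx ?orbT.
Qed.
Lemma pd_L : pd n T \in listL n T js.
Proof. by rewrite /listL !mem_cat !inE !eqxx ?orbT. Qed.
Lemma pz_L : pz n T \in listL n T js.
Proof. by rewrite /listL !mem_cat !inE !eqxx ?orbT. Qed.
Lemma pg_L j k : j \in js -> k < 4 -> pg T (k + j) \in listL n T js.
Proof.
move=> j_js k4; rewrite /listL !mem_cat; do 9 (apply/orP; right); apply/orP; left.
by apply/allpairsP; exists (j, k); rewrite mem_iota.
Qed.
Lemma pG_L j k : j \in js -> k < 3 -> pG T (k + j) \in listL n T js.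
Proof.
move=> j_js k4; rewrite /listL !mem_cat; do 10 (apply/orP; right).
by apply/allpairsP; exists (j, k); rewrite mem_iota.
Qed.
Lemma pr_R i : 2 <= i <= n - 2 -> pr n T i \in listR n T js.
Proof. by move=> ?; rewrite /listR mem_cat map_f // mem_iota; lia. Qed.
Lemma py_R j : j \in js -> py T j.+1 \in listR n T js.
Proof. by move=> ?; rewrite /listR !mem_cat (map_f (fun j => py T j.+1)) ?orbT. Qed.
Lemma pY_R j : j \in js -> pY T j.+1 \in listR n T js.
Proof. by move=> ?; rewrite /listR !mem_cat (map_f (fun j => pY T j.+1)) ?orbT. Qed.
End Mem.

(** * The intersecting case *)

Ltac mem_tac :=
  lazymatch goal with
  | |- is_true (pv _ _ \in _) => apply: pv_L; lia
  | |- is_true (pu _ _ \in _) => apply: pu_L; lia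
  | |- is_true (pU _ _ \in _) => apply: pU_L; lia
  | |- is_true (pq _ _ \in _) => apply: pq_L; lia
  | |- is_true (pw _ _ \in _) => apply: pw_L; lia
  | |- is_true (pt _ _ _ \in _) => apply: pt_L; lia
  | |- is_true (ps _ _ \in _) => apply: ps_L; lia
  | |- is_true (pp _ _ \in _) => apply: pp_L; lia
  | |- is_true (pd _ _ \in _) => exact: pd_L
  | |- is_true (pz _ _ \in _) => exact: pz_L
  | |- is_true (pg _ (_ + _) \in _) => apply: pg_L; [by [] | lia]
  | |- is_true (pG _ (_ + _) \in _) => apply: pG_L; [by [] | lia]
  | |- is_true (py _ _ \in _) => exact: py_R
  | |- is_true (pY _ _ \in _) => exact: pY_R
  | |- is_true (pr _ _ _ \in listL _ _ _) => apply: pr_L; rewrite !inE; lia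
  | |- is_true (pr _ _ _ \in listR _ _ _) => apply: pr_R; lia
  end.

Ltac unfold_pts :=
  cbv beta iota delta [pv pu pU pq pw pt ps pp pr pg pG pd pz py pY].

Ltac split_eq T :=
  repeat match goal with
  | |- context [?a == ?b] =>
     case: (a =P b) => [/(fun E => conj E (congr1 (fun x => Z.of_nat x * T)%ZZ E)) [? ?]|?]
  end.

Ltac coord_near T := unfold_pts; split_eq T; try lia; apply/nearZP; lia.
Ltac coord_far T := unfold_pts; split_eq T; try lia; apply/negP => /nearZP [? ?]; lia.

Lemma near_sym p q : near p q -> near q p.
Proof. by rewrite !nearP; lra. Qed.

Section Coords.
Variables (n : nat) (T : Z) (jA jB : seq nat) (pi : Z * Z -> R * R).
Hypothesis hn : 10 < n.
Hypothesis hT : (10 * Z.of_nat n + 100 <= T)%ZZ.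
Local Notation lL := (listL n T jA).
Local Notation lR := (listR n T jB).
Hypothesis nearL : forall a b, a \in lL -> b \in lL -> nearZ T a b -> near (pi a) (pi b).
Hypothesis nearR : forall a b, a \in lR -> b \in lR -> nearZ T a b -> near (pi a) (pi b).
Hypothesis far : forall a b, (a \in lL) || (a \in lR) -> (b \in lL) || (b \in lR) ->
  ~~ nearZ T a b -> ~ near (pi a) (pi b).
Hypothesis farLR : forall a b, a \in lL -> a \notin lR -> b \in lR -> b \notin lL ->
  ~ near (pi a) (pi b).

Ltac memU := first [apply/orP; left; mem_tac | apply/orP; right; mem_tac].
Lemma chain_x : chain n (pi \o pv T) (pi \o pu T) (pi \o pU T) (pi \o pq T).
Proof.
constructor=> i lt_in; rewrite /comp.
all: lazymatch goal with
 | |- near _ _ => apply: nearL; [mem_tac|mem_tac|]; case: i lt_in => [|[|i]] ?; coord_near T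
 | |- ~ _ => apply: far; [memU|memU|]; case: i lt_in => [|[|i]] ?; coord_far T end.
Qed.

Lemma chain_y : chain n (pi \o pw T) (pi \o pt n T) (pi \o ps T) (pi \o pp T).
Proof.
constructor=> i lt_in; rewrite /comp.
all: lazymatch goal with
 | |- near _ _ => apply: nearL; [mem_tac|mem_tac|]; case: i lt_in => [|[|i]] ?; coord_near T
 | |- ~ _ => apply: far; [memU|memU|]; case: i lt_in => [|[|i]] ?; coord_far T end.
Qed.

Lemma pu_n : pu T n = (Z.of_nat n * (T + 1) + 3, Z.of_nat n * (T - 1) - 2 * T - 6)%ZZ.
Proof. by case: n hn => [|[|m]]. Qed.

Lemma pv_n : pv T n = (Z.of_nat n * (T + 1) + 2, Z.of_nat n * (T - 1) - 3 * T - 6)%ZZ.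
Proof. by case: n hn => [|[|m]]. Qed.

Lemma pt_n : pt n T n = ((Z.of_nat n - 1) * T - Z.of_nat n - 2,
  (Z.of_nat n + 1) * T - Z.of_nat n - 6)%ZZ.
Proof. by rewrite /pt eqxx; case: n hn => [|[|m]]. Qed.

Lemma pr_n : pr n T n = ((Z.of_nat n - 1) * T + Z.of_nat n + 3,
  (Z.of_nat n - 1) * T - Z.of_nat n - 6)%ZZ.
Proof. by rewrite /pr eqxx. Qed.

Lemma pr_in i : i <= n -> (pr n T i \in lL) || (pr n T i \in lR).
Proof.
move=> le_in; case: (boolP (2 <= i <= n - 2)) => [i_mid|i_end].
  by apply/orP; right; apply: pr_R.
by apply/orP; left; apply: pr_L; rewrite ?inE; lia.
Qed.

Ltac site_near :=
  match goal with E : _ = _.+4.+1 |- _ => rewrite E ?addSn ?add0n ?succnK end;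
  coord_near T.
Ltac site_far :=
  match goal with E : _ = _.+4.+1 |- _ => rewrite E ?addSn ?add0n ?succnK end;
  coord_far T.

Lemma embedding_config (j : nat) : j \in jA -> j \in jB -> site n j ->
  (forall a, a \in [:: pG T (0 + j); pG T (1 + j); pG T (2 + j)] -> a \notin lR) ->
  pY T j.+1 \notin lL ->
  config n j (pi \o pv T) (pi \o pu T) (pi \o pU T) (pi \o pq T)
    (pi \o pw T) (pi \o pt n T) (pi \o ps T) (pi \o pp T) (pi \o pr n T)
    (fun i => pi (pg T (i + j))) (fun i => pi (pG T (i + j)))
    (pi (pd n T)) (pi (pz n T)) (pi (py T j.+1)) (pi (pY T j.+1)).
Proof.
move=> jAj jBj /andP[_ j_n] GR YL.
have ? : (11 * T <= Z.of_nat n * T)%ZZ by nia.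
have r0 : pr n T 0 = (0, 0)%ZZ by rewrite pr_mid //; lia.
(* All indices around the site then lie beyond the initial cases of the coordinate functions, which
   reduce to their generic formulas. *)
have [j' Ej] : exists j', j = j'.+4.+1 by exists (j - 5); lia.
have en := (pu_n, pv_n, pt_n, pr_n).
constructor; rewrite /comp; [exact: chain_x|exact: chain_y|..].
- by [].
- by rewrite r0.
- by rewrite r0.
- by apply: far; [memU|memU|]; coord_far T.
- move=> i lt_in.
  case: (boolP (2 <= i < n - 2)) => i_mid.
    by apply: nearR; [mem_tac|mem_tac|]; case: i lt_in i_mid => [|[|i]] ? ?; coord_near T.
  by apply: nearL; [mem_tac|mem_tac|]; case: i lt_in i_mid => [|[|i]] ? ?; coord_near T.
- by apply: far; [memU|memU|]; coord_far T.
- by apply: far; [memU|memU|]; coord_far T.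
- move=> i lt_in; apply: far; [memU|apply: pr_in; lia|].
  by case: i lt_in => [|[|i]] ?; coord_far T.
- by apply: nearL; [mem_tac|mem_tac|]; rewrite en; coord_near T.
- by apply: nearL; [mem_tac|mem_tac|]; rewrite en; coord_near T.
- by apply: nearL; [mem_tac|mem_tac|]; coord_near T.
- by apply: nearL; [mem_tac|mem_tac|]; rewrite en; coord_near T.
- by apply: nearL; [mem_tac|mem_tac|]; rewrite en; coord_near T.
- by apply: far; [memU|memU|]; rewrite en; coord_far T.
- by apply: far; [memU|memU|]; rewrite en; coord_far T.
- by apply: far; [memU|memU|]; rewrite !en; coord_far T.
- by apply: far; [memU|memU|]; rewrite en; coord_far T.
- by lia.
- by move=> i i4; apply: nearL; [mem_tac|mem_tac|]; case: i i4 => [|[|[|[|//]]]] _; site_near.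
- by move=> i i4; apply: nearL; [mem_tac|mem_tac|]; case: i i4 => [|[|[|[|//]]]] _; site_near.
- by move=> i i4; apply: far; [memU|memU|]; case: i i4 => [|[|[|[|//]]]] _; site_far.
- by move=> i i3; apply: nearL; [mem_tac|mem_tac|]; case: i i3 => [|[|[|//]]] _; site_near.
- by move=> i i3; apply: nearL; [mem_tac|mem_tac|]; case: i i3 => [|[|[|//]]] _; site_near.
- by move=> i i3; apply: far; [memU|memU|]; case: i i3 => [|[|[|//]]] _; site_far.
- by move=> i i3; apply: far; [memU|memU|]; case: i i3 => [|[|[|//]]] _; site_far.
- by apply: nearR; [mem_tac|mem_tac|]; site_near.
- by apply: nearR; [mem_tac|mem_tac|]; site_near.
- by apply: far; [memU|memU|]; site_far.
- by move=> i i2; apply: far; [memU|memU|]; case: i i2 => [|[|//]] _; site_far.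
- by apply: far; [memU|memU|]; site_far.
- by apply: far; [memU|memU|]; site_far.
- by move=> i i3; apply: far; [memU|memU|]; case: i i3 => [|[|[|//]]] _; site_far.
- by apply: far; [memU|memU|]; site_far.
- by apply: far; [memU|memU|]; site_far.
- by apply: far; [memU|memU|]; site_far.
- by move=> i i3; apply: far; [memU|memU|]; case: i i3 => [|[|[|//]]] _; site_far.
- by move=> i i3; apply: far; [memU|memU|]; case: i i3 => [|[|[|//]]] _; site_far.
(* The one relation that contradicts the coordinates: some [G] is near [Y] in the drawing, but they
   belong to different sides and are therefore not adjacent in the glued graph. *)
- move=> i i3 nYG; apply: (farLR _ _ _ YL) (near_sym nYG); [mem_tac| |exact: pY_R].
  by apply: GR; case: i i3 {nYG} => [|[|[|//]]] _; rewrite !inE eqxx ?orbT.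
- by move=> i i4; apply: far; [memU|memU|]; case: i i4 => [|[|[|[|//]]]] _; site_far.
Qed.
End Coords.

Section Converse.
Variables (n : nat) (T : Z) (jA jB : seq nat).
Hypothesis hn : 10 < n.
Hypothesis hT : (10 * Z.of_nat n + 100 <= T)%ZZ.
Hypothesis okA : {subset jA <= site n}.
Hypothesis okB : {subset jB <= site n}.

Local Notation H := (glue (plgraph T (spec_L n T jA)) (plgraph T (spec_R T hn jB))).
Local Notation gp := (@gpt T (listL n T jA) (listR n T jB) 2 (spec n T)
  (spec_L n T jA) (spec_R T hn jB)).

Lemma spec_diag i : (spec n T i).1 = (spec n T i).2.
Proof. by rewrite /spec pr_2 ?pr_n2; [case: ifP|lia|lia..]. Qed.

Lemma glue_not_realised j : j \in jA -> j \in jB -> ~ unit_square_graph H.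
Proof.
move=> jAj jBj [p [p_inj p_adj]].
have cs := common_spec hn hT okA okB.
(* The default value never occurs at points of the two lists, since [gpt] is onto them. *)
pose pi a := if [pick x : gV H | gp x == a] is Some x then p x else (0, 0)%Re.
have piE x : pi (gp x) = p x.
  rewrite /pi; case: pickP => [y /eqP E|/(_ x)]; last by rewrite eqxx.
  by rewrite (gpt_inj cs E).
have pi_near a b : (a \in listL n T jA) || (a \in listR n T jB) ->
    (b \in listL n T jA) || (b \in listR n T jB) -> a <> b ->
    near (pi a) (pi b) <-> gadjZ T (listL n T jA) (listR n T jB) a b.
  move=> /orP/(gpt_surj T (spec_L n T jA) (spec_R T hn jB))[x <-].
  move=> /orP/(gpt_surj T (spec_L n T jA) (spec_R T hn jB))[y <-] ne.
  rewrite !piE -(gpt_adj cs) p_adj /near; split=> [|[]//].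
  by split=> // E; apply: ne; rewrite E.
have nearZ_refl a : nearZ T a a by rewrite /nearZ; lia.
have near_refl q : near q q by apply/nearP; lra.
apply: (no_config (embedding_config (pi := pi) hn hT _ _ _ _ jAj jBj (okA jAj) _ _)).
- move=> a b aL bL nab; case: (a =P b) => [->|ne]; first exact: near_refl.
  apply/pi_near => //; rewrite ?aL ?bL //.
  by rewrite /gadjZ /adjZ aL bL nab (introF eqP ne).
- move=> a b aR bR nab; case: (a =P b) => [->|ne]; first exact: near_refl.
  apply/pi_near => //; rewrite ?aR ?bR ?orbT //.
  by rewrite /gadjZ /adjZ aR bR nab (introF eqP ne) orbT.
- move=> a b aU bU nab; rewrite pi_near //; last first.
    by move=> E; move: nab; rewrite E nearZ_refl.
  by rewrite /gadjZ /adjZ (negPf nab) andbF.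
- move=> a b aL aR bR bL; rewrite pi_near ?aL ?bR ?orbT //; last first.
    by move=> E; case/negP: bL; rewrite -E.
  by rewrite adj_far.
(* A point common to both lists is special and hence on the diagonal, which [G] and [Y] avoid. *)
- have G_L : forall k, k < 3 -> pG T (k + j) \in listL n T jA by move=> k; exact: pG_L.
  move=> a; rewrite !inE => aG; apply/negP => aR.
  have [k k3 Ea] : exists2 k, k < 3 & a = pG T (k + j).
    by case/or3P: aG => /eqP ->; [exists 0|exists 1|exists 2].
  have aL : a \in listL n T jA by rewrite Ea G_L.
  have [i Ei] := cs a aL aR; have := spec_diag i; rewrite -Ei Ea /pG /=; nia.
- apply/negP => YL; have [i Ei] := cs _ YL (pY_R n T jBj).
  by have := spec_diag i; rewrite -Ei /pY; cbn [fst snd]; lia.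
Qed.
End Converse.

(** * Connectivity and the neighbourhood of the special vertices *)

Section Reach.
Variables (n : nat) (T : Z) (jA jB : seq nat) (reach : Z * Z -> Prop).
Hypothesis hn : 10 < n.
Hypothesis hT : (10 * Z.of_nat n + 100 <= T)%ZZ.
Hypothesis okA : {subset jA <= site n}.
Hypothesis okB : {subset jB <= site n}.
Local Notation lL := (listL n T jA).
Local Notation lR := (listR n T jB).
Hypothesis stepL : forall a b, a \in lL -> b \in lL -> nearZ T a b -> reach a -> reach b.
Hypothesis stepR : forall a b, a \in lR -> b \in lR -> nearZ T a b -> reach a -> reach b.
Hypothesis reach_o : reach (pv T 0).

Ltac fromL a i le := apply: (stepL (a := a));
  [mem_tac|mem_tac|case: i le => [|[|i]] ?; coord_near T|].

Lemma reach_pv i : i <= n -> reach (pv T i).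
Proof.
elim: i => [//|i IHi] lt_in.
apply: (stepL (a := pu T i)); [mem_tac|mem_tac| |].
  by clear IHi; case: i lt_in => [|[|i]] ?; coord_near T.
apply: (stepL (a := pv T i)); [mem_tac|mem_tac| |by apply: IHi; lia].
by clear IHi; case: i lt_in => [|[|i]] ?; coord_near T.
Qed.

Lemma reach_pu i : i <= n -> reach (pu T i).
Proof. by move=> le_in; fromL (pv T i) i le_in; exact: reach_pv. Qed.

Lemma reach_pU i : i <= n -> reach (pU T i).
Proof. by move=> le_in; fromL (pv T i) i le_in; exact: reach_pv. Qed.

Lemma reach_pq i : i <= n -> reach (pq T i).
Proof.
(* A chain has no [q 0]; index 0 of the drawing repeats index 1. *)
case: i => [_|i le_in]; first by rewrite -[pq T 0]/(pq T 1);
  apply: (stepL (a := pU T 1)); [mem_tac|mem_tac|coord_near T|apply: reach_pU; lia].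
by fromL (pU T i.+1) i le_in; exact: reach_pU.
Qed.

Lemma reach_pw i : i <= n -> reach (pw T i).
Proof.
elim: i => [//|i IHi] lt_in.
apply: (stepL (a := pt n T i)); [mem_tac|mem_tac| |].
  by clear IHi; case: i lt_in => [|[|i]] ?; coord_near T.
apply: (stepL (a := pw T i)); [mem_tac|mem_tac| |by apply: IHi; lia].
by clear IHi; case: i lt_in => [|[|i]] ?; coord_near T.
Qed.

Lemma reach_pt i : i <= n -> reach (pt n T i).
Proof. by move=> le_in; fromL (pw T i) i le_in; exact: reach_pw. Qed.

Lemma reach_ps i : i <= n -> reach (ps T i).
Proof. by move=> le_in; fromL (pw T i) i le_in; exact: reach_pw. Qed.

Lemma reach_pp i : i <= n -> reach (pp T i).
Proof.
case: i => [_|i le_in]; first by rewrite -[pp T 0]/(pp T 1);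
  apply: (stepL (a := ps T 1)); [mem_tac|mem_tac|coord_near T|apply: reach_ps; lia].
by fromL (ps T i.+1) i le_in; exact: reach_ps.
Qed.

Lemma reach_pr i : i <= n -> reach (pr n T i).
Proof.
elim: i => [_|i IHi lt_in].
  by rewrite pr_mid; [exact: (@reach_pu 0)|lia].
have {}IHi : reach (pr n T i) by apply: IHi; lia.
(* Between the special vertices the edges of the path belong to R(B), outside them to L(A). *)
case: (boolP (2 <= i < n - 2)) => i_mid.
  apply: (stepR (a := pr n T i)) => //; [mem_tac|mem_tac|].
  by case: i lt_in i_mid {IHi} => [|[|i]] ? ?; coord_near T.
apply: (stepL (a := pr n T i)) => //; [mem_tac|mem_tac|].
by case: i lt_in i_mid {IHi} => [|[|i]] ? ?; coord_near T.
Qed.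

Lemma reach_pd : reach (pd n T).
Proof.
apply: (stepL (a := pu T n)); [mem_tac|mem_tac| |exact: reach_pu].
by rewrite pu_n //; coord_near T.
Qed.

Lemma reach_pz : reach (pz n T).
Proof. by apply: (stepL (a := pd n T)); [mem_tac|mem_tac|coord_near T|exact: reach_pd]. Qed.

Lemma reach_pg j k : j \in jA -> k < 4 -> reach (pg T (k + j)).
Proof.
move=> jAj k4; have := okA jAj; rewrite unfold_in /site => j_n.
apply: (stepL (a := pu T (k + j))); [mem_tac|mem_tac| |apply: reach_pu; lia].
by have : 1 < k + j; [lia|]; case: (k + j) => [|[|i]] // _; coord_near T.
Qed.

Lemma reach_pG j k : j \in jA -> k < 3 -> reach (pG T (k + j)).
Proof.
move=> jAj k4; have := okA jAj; rewrite unfold_in /site => j_n.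
apply: (stepL (a := pg T (k + j))); [mem_tac|mem_tac| |apply: reach_pg => //; lia].
by coord_near T.
Qed.

Lemma reach_py j : j \in jB -> reach (py T j.+1).
Proof.
move=> jBj; have := okB jBj; rewrite unfold_in /site => j_n.
apply: (stepR (a := pr n T j.+1)); [mem_tac|mem_tac| |apply: reach_pr; lia].
by coord_near T.
Qed.

Lemma reach_pY j : j \in jB -> reach (pY T j.+1).
Proof.
move=> jBj.
by apply: (stepR (a := py T j.+1)); [mem_tac|mem_tac|coord_near T|exact: reach_py].
Qed.

Lemma reach_all a : (a \in lL) || (a \in lR) -> reach a.
Proof.
have up f : (forall i, i <= n -> reach (f i)) -> a \in upto f n.+1 -> reach a.
  by move=> fr /mapP[i]; rewrite mem_iota => lt_i ->; apply: fr.
case/orP; rewrite !mem_cat.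
  do 8 (case/orP; [apply: up; auto using reach_pv, reach_pu, reach_pU, reach_pq,
    reach_pw, reach_pt, reach_ps, reach_pp|]).
  case/orP; [rewrite !inE|case/orP=> /allpairsP[p [jAj]]; rewrite mem_iota => lt_k ->].
  - move=> H; do ?[case/orP: H => [/eqP -> | H]]; try (apply: reach_pr; lia).
      exact: reach_pd.
    by rewrite (eqP H); exact: reach_pz.
  - exact: reach_pg.
  - exact: reach_pG.
case/orP=> [/mapP[i]|/orP[] /mapP[j jBj ->]].
- by rewrite mem_iota => ? ->; apply: reach_pr; lia.
- exact: reach_py.
- exact: reach_pY.
Qed.
End Reach.

Section Connected.
Variables (n : nat) (T : Z) (jA jB : seq nat).
Hypothesis hn : 10 < n.
Hypothesis hT : (10 * Z.of_nat n + 100 <= T)%ZZ.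
Hypothesis okA : {subset jA <= site n}.
Hypothesis okB : {subset jB <= site n}.
Local Notation H := (glue (plgraph T (spec_L n T jA)) (plgraph T (spec_R T hn jB))).
Local Notation gp := (@gpt T (listL n T jA) (listR n T jB) 2 (spec n T)
  (spec_L n T jA) (spec_R T hn jB)).

Lemma glue_connected : connected_graph H.
Proof.
have cs := common_spec hn hT okA okB.
have sym : connect_sym (@gadj H).
  by apply: sym_connect_sym => x y; rewrite !(gpt_adj cs) gadjZ_sym.
have surj a := gpt_surj T (spec_L n T jA) (spec_R T hn jB) (a := a).
have [o Eo] := surj _ (or_introl (@pv_L n T jA 0 isT)).
have step a b : gadjZ T (listL n T jA) (listR n T jB) a b ->
    (forall x, gp x = a -> connect (@gadj H) o x) ->
    forall x, gp x = b -> connect (@gadj H) o x.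
  move=> ab ra x Ex; have [y Ey] : exists y, gp y = a.
    by apply: surj; case/andP: ab => _ /orP[]/andP[]; auto.
  by apply: (connect_trans (ra y Ey)); apply: connect1; rewrite (gpt_adj cs) Ey Ex.
have all x : connect (@gadj H) o x.
  apply: (reach_all (reach := fun a => forall x, gp x = a -> connect (@gadj H) o x)
    hn hT okA okB _ _ _ (gpt_mem x) _ (erefl _)).
  - move=> a b aL bL nab; case: (a =P b) => [->//|ne]; apply: step.
    by rewrite /gadjZ /adjZ aL bL nab (introF eqP ne).
  - move=> a b aL bL nab; case: (a =P b) => [->//|ne]; apply: step.
    by rewrite /gadjZ /adjZ aL bL nab (introF eqP ne) orbT.
  - by move=> y Ey; rewrite (gpt_inj cs (etrans Ey (esym Eo))).
by move=> x y; apply: connect_trans (all y); rewrite sym.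
Qed.
End Connected.

Lemma adjZ_intro T (a1 a2 b1 b2 : Z) : (a1 <> b1 \/ a2 <> b2)%ZZ ->
  (- T <= a1 - b1 <= T /\ - T <= a2 - b2 <= T)%ZZ -> adjZ T (a1, a2) (b1, b2).
Proof.
move=> ne near_ab; rewrite /adjZ (iffRL (nearZP _ _ _ _ _) near_ab).
by rewrite andbT; apply/eqP => -[? ?]; case: ne.
Qed.

Section Nbhd.
Variables (n : nat) (T : Z).
Hypothesis hn : 10 < n.
Hypothesis hT : (10 * Z.of_nat n + 100 <= T)%ZZ.
Let hN : (11 <= Z.of_nat n)%ZZ. Proof. by clear -hn; lia. Qed.

(** The special vertices [r 2] and [r (n - 2)] together with their neighbours on the path, one on
    each side of the gluing. *)
Definition nbhd_pts : seq (Z * Z) :=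
  [seq pr n T i | i <- [:: 1; 2; 3; n - 3; n - 2; n - 1]].

Section Lists.
Variables (jA jB : seq nat).
Hypothesis okA : {subset jA <= site n}.
Hypothesis okB : {subset jB <= site n}.
Local Notation lL := (listL n T jA).
Local Notation lR := (listR n T jB).
Local Notation adj := (gadjZ T lL lR).

Lemma nbhd_in a : a \in nbhd_pts -> (a \in lL) || (a \in lR).
Proof. by case/mapP=> i; rewrite !inE => Hi ->; apply: pr_in; lia. Qed.

Lemma pr_adj_L i j : i \in [:: 1; 2; n - 2; n - 1] -> j \in [:: 1; 2; n - 2; n - 1] ->
  adjZ T (pr n T i) (pr n T j) -> adj (pr n T i) (pr n T j).
Proof.
move=> iE jE E; rewrite /gadjZ E /= !(pr_L T jA) //; move: iE jE; rewrite !inE; lia.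
Qed.

Lemma pr_adj_R i j : 2 <= i <= n - 2 -> 2 <= j <= n - 2 ->
  adjZ T (pr n T i) (pr n T j) -> adj (pr n T i) (pr n T j).
Proof. by move=> iE jE E; rewrite /gadjZ E /= !(pr_R T jB) // orbT. Qed.

Lemma pr_near i j : i < n -> j < n -> nearZ T (pr n T i) (pr n T j) -> i <= j.+1 /\ j <= i.+1.
Proof.
have bd := mulT_N hN hT.
move=> lt_i lt_j; rewrite /pr; case: (i =P n) => [|_]; [lia|]; case: (j =P n) => [|_]; [lia|].
have := mulT_cases hN hT (Z.of_nat i) (Z.of_nat j).
have := mulT_cases hN hT (Z.of_nat i) (Z.of_nat n - 2).
have := mulT_cases hN hT (Z.of_nat j) (Z.of_nat n - 2).
have := mulT_cases hN hT (Z.of_nat i) (Z.of_nat j - 1).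
have := mulT_cases hN hT (Z.of_nat j) (Z.of_nat i - 1).
case: (i.+1 =P n) => Ei; case: (j.+1 =P n) => Ej; move=> ? ? ? ? ? /nearZP[? ?]; lia.
Qed.

(** Two of these points that are adjacent in the drawing are consecutive on the path, so they lie
    together in one list. The induced graph is thus the same for all A and B. *)
Lemma nbhd_adj a b : a \in nbhd_pts -> b \in nbhd_pts -> adj a b = adjZ T a b.
Proof.
move=> /mapP[i iE ->] /mapP[j jE ->]; apply/idP/idP => [/andP[]//|E].
have [_ nE] := andP E.
have [? ?] : i <= j.+1 /\ j <= i.+1.
  by apply: pr_near nE; move: iE jE; rewrite !inE; lia.
move: iE jE; rewrite !inE => iE jE.
case: (boolP (2 <= i <= n - 2)) => [i2|i_end].
  case: (boolP (2 <= j <= n - 2)) => [j2|j_end]; first exact: pr_adj_R.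
  by apply: pr_adj_L E; rewrite !inE; lia.
by apply: pr_adj_L E; rewrite !inE; lia.
Qed.

Lemma spec_mem i : spec n T i \in nbhd_pts.
Proof. by rewrite /spec; case: eqP => _; apply: map_f; rewrite !inE eqxx ?orbT. Qed.

Lemma adj_spec i a : adj (spec n T i) a -> a \in nbhd_pts.
Proof.
move=> /andP[/andP[/eqP ne na]] /orP[/andP[_ /(mem_L hn okA) aL]|/andP[_ /(mem_R hn okB) aR]].
- move: ne na; rewrite /spec; case: ifP => _ ne na.
    have -> : a = pr n T 1.
      rewrite pr_2 // in ne na; rewrite (near_s1 hN hT aL na (nesym ne)) pr_mid; last by lia.
      by congr (_, _); lia.
    by apply: map_f; rewrite !inE eqxx.
  have -> : a = pr n T (n - 1).
    by rewrite pr_n2 // in ne na; rewrite (near_s2 hN hT aL na (nesym ne)) subn1 pr_pred //; lia.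
  by apply: map_f; rewrite !inE eqxx ?orbT.
- case: aR => [->|->|sa]; try by apply: map_f; rewrite !inE eqxx ?orbT.
  move: ne na; rewrite /spec; case: ifP => _ ne na.
    have -> : a = pr n T 3.
      rewrite pr_2 // in na; rewrite (near_s1_R hN hT sa na) pr_mid //; lia.
    by apply: map_f; rewrite !inE eqxx ?orbT.
  have -> : a = pr n T (n - 3).
    by rewrite pr_n2 // in na; rewrite (near_s2_R hN hT sa na) pr_mid ?Nat2Z.inj_sub //; lia.
  by apply: map_f; rewrite !inE eqxx ?orbT.
Qed.

Local Notation H := (glue (plgraph T (spec_L n T jA)) (plgraph T (spec_R T hn jB))).
Local Notation gp := (@gpt T lL lR 2 (spec n T) (spec_L n T jA) (spec_R T hn jB)).
Local Notation Sp := (glueS 2 (plgraph T (spec_L n T jA)) (plgraph T (spec_R T hn jB))).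

Lemma mem_nbhd (x : gV H) : (x \in closed_nbhd Sp) = (gp x \in nbhd_pts).
Proof.
have cs := common_spec hn hT okA okB.
rewrite in_setU [x \in [set v | _]]inE; apply/idP/idP.
  case/orP=> [/imsetP[i _ ->]|/existsP[u /andP[/imsetP[i _ ->]]]].
    exact (spec_mem i).
  by rewrite (gpt_adj cs); apply: adj_spec.
move=> /mapP[i iE Ei].
have inS u : gp x = spec n T u -> x \in Sp.
  by move=> E; apply/imsetP; exists u => //; apply: (gpt_inj cs).
have near_S u : adjZ T (spec n T u) (gp x) -> [exists v in Sp, gadj v x].
  move=> E; apply/existsP; exists (glab 2 _ _ u); apply/andP; split.
    by apply/imsetP; exists u.
  by rewrite (gpt_adj cs) /= nbhd_adj ?spec_mem // Ei map_f.
have r01 : adjZ T (pr n T 2) (pr n T 1).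
  by rewrite !pr_mid; [apply: adjZ_intro; [left|split]; lia|lia|lia].
have r23 : adjZ T (pr n T 2) (pr n T 3).
  by rewrite !pr_mid; [apply: adjZ_intro; [left|split]; lia|lia|lia].
have rn1 : adjZ T (pr n T (n - 2)) (pr n T (n - 1)).
  by rewrite pr_n2 // subn1 pr_pred; [apply: adjZ_intro; [left|split]; lia|lia].
have rn3 : adjZ T (pr n T (n - 2)) (pr n T (n - 3)).
  by rewrite pr_n2 // pr_mid ?Nat2Z.inj_sub; [apply: adjZ_intro; [left|split]; lia|lia|lia].
move: iE; rewrite !inE => /or4P[/eqP iE|/eqP iE|/eqP iE|/or3P[]/eqP iE].
all: rewrite iE in Ei; apply/orP; first
  [ by left; apply: (inS ord0) | by left; apply: (inS (lift ord0 ord0))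
  | by right; apply: (near_S ord0); rewrite Ei
  | by right; apply: (near_S (lift ord0 ord0)); rewrite Ei ].
Qed.

Lemma card_nbhd : #|closed_nbhd Sp| <= 6.
Proof.
have cs := common_spec hn hT okA okB.
rewrite cardE -(size_map gp); apply: (@uniq_leq_size _ _ nbhd_pts).
  by rewrite (map_inj_uniq (gpt_inj cs)) enum_uniq.
by move=> a /mapP[x]; rewrite mem_enum mem_nbhd => xN ->.
Qed.
End Lists.

Section Iso.
Variables (jA jB jA' jB' : seq nat).
Hypothesis okA : {subset jA <= site n}.
Hypothesis okB : {subset jB <= site n}.
Hypothesis okA' : {subset jA' <= site n}.
Hypothesis okB' : {subset jB' <= site n}.
Local Notation gL := (plgraph T (spec_L n T jA)).
Local Notation gR := (plgraph T (spec_R T hn jB)).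
Local Notation gL' := (plgraph T (spec_L n T jA')).
Local Notation gR' := (plgraph T (spec_R T hn jB')).
Local Notation gp := (@gpt T _ _ 2 (spec n T) (spec_L n T jA) (spec_R T hn jB)).
Local Notation gp' := (@gpt T _ _ 2 (spec n T) (spec_L n T jA') (spec_R T hn jB')).

Lemma nbhd_iso : exists f : gV (glue gL gR) -> gV (glue gL' gR'),
  induced_iso (closed_nbhd (glueS 2 gL gR)) (closed_nbhd (glueS 2 gL' gR')) f /\
  forall i, f (glab 2 gL gR i) = glab 2 gL' gR' i.
Proof.
have cs := common_spec hn hT okA okB; have cs' := common_spec hn hT okA' okB'.
(* A vertex goes to the vertex at the same point; the default can occur only outside the
   neighbourhood. *)
pose f x := odflt (glab 2 gL' gR' ord0) [pick y | gp' y == gp x].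
have fE x : gp x \in nbhd_pts -> gp' (f x) = gp x.
  move=> xN; rewrite /f; case: pickP => [y /eqP //|none].
  have [y Ey] := gpt_surj T (spec_L n T jA') (spec_R T hn jB') (orP (nbhd_in jA' jB' xN)).
  by have := none y; rewrite Ey eqxx.
exists f; split; last by move=> i; apply: (gpt_inj cs'); rewrite fE ?spec_mem.
split; [|split].
- move=> x y; rewrite !mem_nbhd // => xN yN E; apply: (gpt_inj cs).
  by rewrite -(fE x) // -(fE y) // E.
- apply/setP => y; rewrite mem_nbhd //; apply/imsetP/idP => [[x]|yN].
    by rewrite mem_nbhd // => xN ->; rewrite fE.
  have [x Ex] := gpt_surj T (spec_L n T jA) (spec_R T hn jB) (orP (nbhd_in jA jB yN)).
  exists x; first by rewrite mem_nbhd // Ex.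
  by apply: (gpt_inj cs'); rewrite fE Ex.
- move=> x y; rewrite !mem_nbhd // => xN yN.
  by rewrite (gpt_adj cs) (gpt_adj cs') !nbhd_adj ?fE.
Qed.
End Iso.
End Nbhd.

(** * Sizes, and the encoding of subsets by sites *)

Lemma size_listL n T js : size (listL n T js) = 8 * n.+1 + 8 + 7 * size js.
Proof. by rewrite !size_cat !size_map !size_allpairs !size_iota /=; lia. Qed.

Lemma size_listR n T js : size (listR n T js) = n - 3 + 2 * size js.
Proof. by rewrite !size_cat !size_map size_iota; lia. Qed.

(** Spacing 4 gives each site its own four indices for the [g], and the offset 5 makes every site
    odd and large enough. *)
Definition sites N (X : {set 'I_N}) : seq nat := [seq 4 * val i + 5 | i <- enum X].

Lemma sites_ok N (X : {set 'I_N}) : {subset sites X <= site (4 * N + 11)}.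
Proof. by move=> j /mapP[i _ ->]; have := ltn_ord i; rewrite unfold_in /site /=; lia. Qed.

Lemma size_sites N (X : {set 'I_N}) : size (sites X) <= N.
Proof. by rewrite size_map -cardE (leq_trans (max_card _)) ?card_ord. Qed.

Lemma mem_sites N (X : {set 'I_N}) (i : 'I_N) : (4 * i + 5 \in sites X) = (i \in X).
Proof.
apply/mapP/idP => [[j]|iX]; last by exists i; rewrite ?mem_enum.
by rewrite mem_enum => jX E; rewrite (_ : i = j) //; apply: ord_inj; rewrite /= in E; lia.
Qed.

Theorem theorem6p5 : disjointness_expressing triangle_free_unit_square 6 1.
Proof.
(* With n = 4 N + 11 the two lists have at most 9 n + 13 + 9 N = 45 N + 112 points, which is at most
   200 N. *)
exists (200)%Re; split=> [|N N0]; first by lra.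
(* The largest possible site, 4 (N - 1) + 5, is exactly n - 10. *)
pose n := 4 * N + 11; pose T := (10 * Z.of_nat n + 100)%ZZ.
have hn : 10 < n by lia.
have hT : (10 * Z.of_nat n + 100 <= T)%ZZ by lia.
have ok X := @sites_ok N X.
exists 2, (fun X => plgraph T (spec_L n T (sites X))),
  (fun X => plgraph T (spec_R T hn (sites X))).
have spec_i := spec_inj hn hT.
split=> [X|]; first by split; [exact: simple_plgraph|move=> i j /(congr1 val)/spec_i].
split=> [X|A B]; first by split; [exact: simple_plgraph|move=> i j /(congr1 val)/spec_i].
split; first exact (glue_connected hT (ok A) (ok B)).
split.
  have le200 : #|gV (glue (plgraph T (spec_L n T (sites A))) (plgraph T (spec_R T hn (sites B))))|
      <= 200 * N.
    rewrite (leq_trans (card_glue _ _ _ (common_spec hn hT (ok A) (ok B)))) //.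
    rewrite size_listL size_listR.
    by have := size_sites A; have := size_sites B; lia.
  rewrite Rinv_1 Rpower_1; last by apply: lt_0_INR; lia.
  apply: (Rle_trans _ (INR (200 * N))); first by apply: le_INR; apply/leP.
  by rewrite !INR_IZR_INZ -mult_IZR; apply: IZR_le; lia.
split; first by move=> A' B'; exact (nbhd_iso hn hT (ok A) (ok B) (ok A') (ok B')).
split; first exact (card_nbhd hn hT (ok A) (ok B)).
(* Triangles never occur, so membership in the class depends only on the existence of a drawing. *)
split=> [[us _]|AB0].
  apply/setP => i; rewrite !inE; apply/negP => /andP[iA iB].
  by apply: (glue_not_realised hT (ok A) (ok B) (j := 4 * i + 5) _ _ us); rewrite mem_sites.
split; last exact (glue_triangle_free hT (ok A) (ok B)).
apply: (glue_realised hn hT (ok A) (ok B)) => j /mapP[i iA ->]; rewrite mem_sites => iB.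
by have := in_set0 i; rewrite -AB0 inE iB andbT -mem_enum iA.
Qed.
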